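(* Let $(\varphi,\psi,\kappa)$ be a diagonal frame decomposition of $A$. Assume that for any $P_\varepsilon\in\Psi$ there exists a constant $c>0$ such that $\Delta_n\ge c\,\kappa_n\Pi_n$ for all $n$ large enough. Then the family $\{R^{\mathrm{MSE}^*}_{P_\varepsilon}\}_{P_\varepsilon\in\Psi}$ is a convergent data-driven regularization over the fixed distribution $P_x$. In particular, $$\lim_{\delta\to0}\ \sup\Big\{\mathbb E_{x\sim P_x,\varepsilon\sim P_\varepsilon}\big[\|A^\dagger Ax-R^{\mathrm{MSE}^*}_{P_\varepsilon}(Ax+\varepsilon)\|^2\big]\ \Big|\ P_\varepsilon\in\Psi,\ \boldsymbol\delta(P_\varepsilon)\le\delta\Big\}=0 .$$ Denote the supremum above by $E(\delta)$, and let $\lesssim$ mean inequality up to a multiplicative constant independent of $\delta$. (i) If there exist constants $a>1$ and $b\in\mathbb R$ such that $\Pi_n=O(n^{-a})$ and $\Delta_n(P_\varepsilon)/\kappa_n^2=O(\boldsymbol\delta(P_\varepsilon)^2n^b)$ uniformly for all $P_\varepsilon\in\Psi$ (i.e. with one constant valid for all $P_\varepsilon\in\Psi$), then the speed of convergence is of order $\delta^{2\frac{a-1}{a+b}}$, i.e. $E(\delta)\lesssim\delta^{2\frac{a-1}{a+b}}$. (ii) If there exist constants $\mu\ge0$ and $c<\infty$ and $\beta_n\geq 0$ such that $\Pi_n=\kappa_n^{4\mu}\beta_n$, and for all $P_\varepsilon\in\Psi$ there exist $\gamma_n\ge0$ such that $\Delta_n(P_\varepsilon)=\boldsymbol\delta(P_\varepsilon)^2\gamma_n$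 and $\sum_{n\in\mathbb N}\beta_n^{\frac1{1+2\mu}}\gamma_n^{\frac{2\mu}{1+2\mu}}\le c$, then the speed of convergence is of order $\delta^{2\frac{2\mu}{1+2\mu}}$, i.e. $E(\delta)\lesssim\delta^{2\frac{2\mu}{1+2\mu}}$.
   Context: $X,Y$ are real Hilbert spaces, $A:X\to Y$ is a compact linear operator, $A^\dagger$ its pseudo-inverse (so $A^\dagger A$ is the orthogonal projection onto $\mathcal N(A)^\perp$); $\mathbb N=\{1,2,\dots\}$. A sequence $(\varphi_n)\subset Z$ in a linear subspace $Z$ is a frame for $Z$ if there are $0<a_\varphi\le b_\varphi<\infty$ with $a_\varphi\|x\|^2\le\sum_n\langle x,\varphi_n\rangle^2\le b_\varphi\|x\|^2$ for all $x\in Z$. The analysis operator is $F_\varphi x=(\langle x,\varphi_n\rangle)_n\in\ell^2$. The dual frame is $\bar\varphi_n=(F_\varphi^*F_\varphi)^{-1}\varphi_n$ (inverse taken on $Z$), and $\bar F_\varphi^*c=\sum_n c_n\bar\varphi_n$ is its synthesis operator. A system $(\varphi,\psi,\kappa)=(\varphi_n,\psi_n,\kappa_n)_{n\in\mathbb N}$ is a diagonal frame decomposition of $A$ if $\varphi$ is a frame for $\mathcal N(A)^\perp$, $\psi$ is a frame for $\overline{\mathcal R(A)}$, $\kappa_n>0$, and $A^*\psi_n=\kappa_n\varphi_n$ for all $n$. $P_x$ is a fixed probability distribution on $X$ with $\mathbb E_{x\sim P_x}[\|x\|^2]<\infty$. $\Psi$ is a family of noise distributions. The noise $\varepsilon\sim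 P_\varepsilon$ is independent of $x$, has zero mean, and enters only through its coefficients $\langle\varepsilon,\psi_n\rangle$, which are zero-mean square-integrable real random variables (so noise that is not $Y$-valued is allowed). $\Pi_n=\mathbb E_{x\sim P_x}[\langle x,\varphi_n\rangle^2]$, $\Delta_n=\Delta_n(P_\varepsilon)=\mathbb E_{\varepsilon\sim P_\varepsilon}[\langle\varepsilon,\psi_n\rangle^2]$, and the noise level is $\boldsymbol\delta(P_\varepsilon)=\sqrt{\sup_n\Delta_n(P_\varepsilon)}$. For a real sequence $g$, $R[g](y)=\sum_n g_n\langle y,\psi_n\rangle\bar\varphi_n=\bar F_\varphi^*(g\cdot F_\psi y)$ (componentwise product); for $y=Ax+\varepsilon$ the coefficients are $\langle Ax+\varepsilon,\psi_n\rangle=\kappa_n\langle x,\varphi_n\rangle+\langle\varepsilon,\psi_n\rangle$. Put $R^{\mathrm{MSE}^*}_{P_\varepsilon}=R[g^{\mathrm{MSE}^*}_{P_\varepsilon,P_x}]$ with $(g^{\mathrm{MSE}^*}_{P_\varepsilon,P_x})_n=\frac{\kappa_n\Pi_n}{\kappa_n^2\Pi_n+\Delta_n}$ (convention $0/0=0$). A family $\{R_{P_\varepsilon}\}_{P_\varepsilon\in\Psi}$ is a data-driven regularization if $R_{P_\varepsilon}:Y\to X$ is continuous for every $P_\varepsilon\in\Psi$. It is convergent over $P_x$ if there is a parameter choice rule $(\delta,P_\varepsilon)\mapsto\tilde P_\varepsilon$ such that $\lim_{\delta\to0}\sup\{\mathbb E_{x\sim P_x,\varepsilon\sim P_\varepsilon}[\|A^\dagger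 Ax-R_{\tilde P_\varepsilon}(Ax+\varepsilon)\|^2] : P_\varepsilon\in\Psi,\ \boldsymbol\delta(P_\varepsilon)\le\delta\}=0$. Convention: $0^0=1$.
   Formalization: Part (i) is proved only for b > -1 instead of every real b; for b ≤ -1 the claimed rate fails (e.g. κ_n = 1/n, Π_n = n^{-3}, Δ_n = t²n^{-4}, a = 3, b = -2), and the exponent is undefined at a + b = 0. *)

(* Defs.v *)
(* Sequences (u_n)_{n >= 1} are indexed from 0: the index n stands for n + 1. *)
From HB Require Import structures.
From mathcomp Require Import all_boot all_order all_algebra.
From mathcomp Require Import all_classical all_reals all_analysis.

Set Implicit Arguments.
Unset Strict Implicit.
Unset Printing Implicit Defensive.

Import Order.TTheory GRing.Theory Num.Theory.
Import numFieldNormedType.Exports.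

Local Open Scope classical_set_scope.
Local Open Scope ring_scope.

(* Real Hilbert spaces: Banach spaces whose norm comes from an inner product,
   i.e. from a symmetric positive definite bilinear form. *)
HB.mixin Record isHilbert (R : realType) X of CompleteNormedModule R X := {
  inner : {dot X for (@idfun R)} ;
  inner_norm : forall x : X, inner x x = `|x| ^+ 2 }.

#[short(type="hilbertType")]
HB.structure Definition Hilbert (R : realType) :=
  {X of CompleteNormedModule R X & isHilbert R X}.

Section Operators.
Context {R : realType} {X Y : hilbertType R}.
Implicit Types (A : X -> Y) (S : set X).

Definition orth S : set X := [set x | forall z, S z -> inner x z = 0].

Definition compact_operator A :=
  forall B : set X, bounded_set B -> precompact (A @` B).

Definition kernel A : set X := [set x | A x = 0].

(* The value at y is unique; it exists whenever A is linear and bounded. *)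
Definition adjoint A (y : Y) : X :=
  xget 0 [set z | forall x, inner (A x) y = inner x z].

End Operators.

(* Moore-Penrose inverse: on its domain R(A) + R(A)^_|_, the inverse of the
   restriction of A to N(A)^_|_, extended by 0 on R(A)^_|_. The value outside
   the domain is irrelevant. *)
Definition pseudo_inverse {R : realType} {X Y : hilbertType R} (A : X -> Y)
    (y : Y) : X :=
  xget 0 [set x | orth (kernel A) x /\ orth (range A) (y - A x)].

Section Frames.
Context {R : realType} {X : hilbertType R}.
Implicit Types (phi : nat -> X) (Z : set X) (c : nat -> R).

Definition is_frame phi Z :=
  (forall n, Z (phi n)) /\
  exists a b : R, 0 < a <= b /\ forall x, Z x ->
    ((a * `|x| ^+ 2)%:E <= \sum_(0 <= n <oo) (inner x (phi n) ^+ 2)%:E)%E /\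
    (\sum_(0 <= n <oo) (inner x (phi n) ^+ 2)%:E <= (b * `|x| ^+ 2)%:E)%E.

Definition analysis phi (x : X) : nat -> R := fun n => inner x (phi n).

(* The adjoint of the analysis operator, as a norm-convergent series. *)
Definition synthesis phi c : X := limn (series (fun n => c n *: phi n)).

Definition frame_operator phi (x : X) : X := synthesis phi (analysis phi x).

(* (F^* F)^{-1} phi_n, where F^* F is inverted as an operator on Z. *)
Definition dual_frame Z phi (n : nat) : X :=
  xget 0 [set z | Z z /\ frame_operator phi z = phi n].

End Frames.

Definition diagonal_frame_decomposition {R : realType} {X Y : hilbertType R}
    (A : X -> Y) (phi : nat -> X) (psi : nat -> Y) (kappa : nat -> R) :=
  [/\ is_frame phi (orth (kernel A)),
      is_frame psi (closure (range A)),
      forall n, 0 < kappa n &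
      forall n, adjoint A (psi n) = kappa n *: phi n].

Definition borel {R : realType} (X : hilbertType R) :=
  g_sigma_algebraType (@open X).

Definition cylinder (R : realType) : set (set (nat -> R)) :=
  \bigcup_n preimage_set_system setT (fun e : nat -> R => e n) measurable.

Definition coef_space (R : realType) := g_sigma_algebraType (@cylinder R).

(* The noise enters only through its coefficients <eps, psi_n>, and need not be
   Y-valued: a noise distribution is the law of the coefficient sequence, a
   probability on R^nat with the product sigma-algebra. *)
Definition noise_law (R : realType) := probability (coef_space R) R.

Definition centered_square_integrable {R : realType} (P : noise_law R) :=
  forall n : nat,
    P.-integrable setT (fun e : coef_space R => (e n ^+ 2)%:E) /\
    ('E_P[fun e : coef_space R => e n] = 0)%E.

Section Regularization.
Context {R : realType} {X Y : hilbertType R}.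
Variables (A : X -> Y) (phi : nat -> X) (psi : nat -> Y) (kappa : nat -> R).
Variable Px : probability (borel X) R.
Implicit Types (P : noise_law R) (Psi : set (noise_law R)).

Definition signal_var (n : nat) : R :=
  fine 'E_Px[fun x : borel X => inner (x : X) (phi n) ^+ 2].

Definition noise_var P (n : nat) : R :=
  fine 'E_P[fun e : coef_space R => e n ^+ 2].

Definition noise_level P : \bar R :=
  sqrte (ereal_sup (range (fun n => (noise_var P n)%:E))).

(* R[g] in terms of data coefficients: R[g](y) = coef_reg g (analysis psi y). *)
Definition coef_reg (g : nat -> R) (c : nat -> R) : X :=
  synthesis (dual_frame (orth (kernel A)) phi) (fun n => g n * c n).

(* Division by 0 yields 0, hence 0 / 0 = 0. *)
Definition g_mse P (n : nat) : R :=
  kappa n * signal_var n / (kappa n ^+ 2 * signal_var n + noise_var P n).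

Definition R_mse P : (nat -> R) -> X := coef_reg (g_mse P).

(* E || A^dagger A x - G (A x + eps) ||^2, for x and eps independent; G acts on
   data coefficients since A x + eps need not be an element of Y. *)
Definition mean_squared_error (G : (nat -> R) -> X) P : \bar R :=
  (\int[Px \x P]_w
    (`| pseudo_inverse A (A (w.1 : X))
        - G (fun n => analysis psi (A (w.1 : X)) n + w.2 n) | ^+ 2)%:E)%E.

(* Adjoining 0 makes the supremum over an empty set of noise laws equal to 0
   (errors are nonnegative). *)
Definition worst_case_error Psi (G : noise_law R -> (nat -> R) -> X) (delta : R)
    : \bar R :=
  ereal_sup (0%E |` [set mean_squared_error (G P) P |
                      P in [set P | Psi P /\ (noise_level P <= delta%:E)%E]]).

Definition data_driven_regularization Psi
    (G : noise_law R -> (nat -> R) -> X) :=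
  forall P, Psi P -> continuous (fun y : Y => G P (analysis psi y)).

Definition convergent_over Psi (G : noise_law R -> (nat -> R) -> X) :=
  exists rule : R -> noise_law R -> noise_law R,
    (forall delta P, Psi P -> Psi (rule delta P)) /\
    worst_case_error Psi (fun P => G (rule delta P)) delta
      @[delta --> 0^'+] --> 0%E.

End Regularization.

(* Main.v *)
(* With S the frame operator of phi on N(A)^_|_, synthesis with the dual frame is
   S^-1 F_phi^*, so it is bounded on l^2, and A^dagger A x has dual frame
   coefficients <x, phi_n>. Hence the error at x with noise coefficients e_n is
   the synthesis of (1 - g_n kappa_n) <x, phi_n> - g_n e_n, and for the MSE
   filter its mean square is at most a constant times the sum over n of
   Pi_n Delta_n / (kappa_n^2 Pi_n + Delta_n)
     <= min (Pi_n, Delta_n / kappa_n^2) <= min (Pi_n, delta^2 / kappa_n^2).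
   As Pi_n is summable, dominated convergence gives the limit. Rate (i) splits
   the sum where the two power laws cross; rate (ii) bounds the minimum by the
   geometric mean with weights 1/(1+2mu) and 2mu/(1+2mu). The lower bound on
   Delta_n makes the filter bounded, hence each reconstruction continuous. *)
Require Import Defs.
From HB Require Import structures.
From mathcomp Require Import all_boot all_order all_algebra.
From mathcomp Require Import all_classical all_reals all_analysis.
From mathcomp Require Import measurable_realfun lebesgue_integral_fubini.
From mathcomp Require Import ring lra zify.

Set Implicit Arguments.
Unset Strict Implicit.
Unset Printing Implicit Defensive.

Import Order.TTheory GRing.Theory Num.Theory.
Import numFieldNormedType.Exports.

Local Open Scope classical_set_scope.
Local Open Scope ring_scope.

(** * Real Hilbert spaces *)

Section InnerProduct.
Context {R : realType} {X : hilbertType R}.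
Implicit Types (x y z : X) (t : R).

Lemma innerC x y : inner x y = inner y x.
Proof. by rewrite hermC expr0 mul1r. Qed.

Lemma innerDl x y z : inner (x + y) z = inner x z + inner y z.
Proof. exact: linearDl. Qed.

Lemma innerDr x y z : inner z (x + y) = inner z x + inner z y.
Proof. by rewrite !(innerC z) innerDl. Qed.

Lemma innerNl x z : inner (- x) z = - inner x z.
Proof. exact: linearNl. Qed.

Lemma innerBl x y z : inner (x - y) z = inner x z - inner y z.
Proof. by rewrite innerDl innerNl. Qed.

Lemma innerZl t x z : inner (t *: x) z = t * inner x z.
Proof. exact: linearZl_LR. Qed.

Lemma innerZr t x z : inner z (t *: x) = t * inner z x.
Proof. by rewrite !(innerC z) innerZl. Qed.

Lemma inner0l z : inner (0 : X) z = 0.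
Proof. by rewrite -(scale0r (0 : X)) innerZl mul0r. Qed.

Lemma inner0r z : inner z (0 : X) = 0.
Proof. by rewrite innerC inner0l. Qed.

Lemma inner_suml (I : Type) (r : seq I) (Q : pred I) (F : I -> X) z :
  inner (\sum_(i <- r | Q i) F i) z = \sum_(i <- r | Q i) inner (F i) z.
Proof.
by elim/big_rec2: _ => [|i u v _ <-]; rewrite ?inner0l ?innerDl.
Qed.

Lemma normD_sqr x y : `|x + y| ^+ 2 = `|x| ^+ 2 + 2 * inner x y + `|y| ^+ 2.
Proof.
by rewrite -!inner_norm innerDl !innerDr (innerC y x); ring.
Qed.

Lemma normB_sqr x y : `|x - y| ^+ 2 = `|x| ^+ 2 - 2 * inner x y + `|y| ^+ 2.
Proof. by rewrite normD_sqr normrN innerC innerNl innerC; ring. Qed.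

Lemma Cauchy_Schwarz x y : `|inner x y| <= `|x| * `|y|.
Proof.
have [->|y0] := eqVneq y 0; first by rewrite inner0r !normr0 mulr0.
have ny : 0 < `|y| by rewrite normr_gt0.
rewrite -(@ler_pXn2r _ 2)// ?nnegrE ?mulr_ge0// exprMn real_normK ?num_real//.
have := sqr_ge0 `|x - (inner x y / `|y| ^+ 2) *: y|.
rewrite normB_sqr innerZr normrZ exprMn real_normK ?num_real//.
set s := inner x y => h.
have : 0 <= (`|x| ^+ 2 - s ^+ 2 / `|y| ^+ 2) * `|y| ^+ 2.
  apply: mulr_ge0 => //; suff -> : `|x| ^+ 2 - s ^+ 2 / `|y| ^+ 2 =
    `|x| ^+ 2 - 2 * (s / `|y| ^+ 2 * s) + (s / `|y| ^+ 2) ^+ 2 * `|y| ^+ 2 by [].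
  by field; rewrite gt_eqF.
by rewrite mulrBl divfK ?subr_ge0// gt_eqF// exprn_gt0.
Qed.

Lemma cvg_inner (T : Type) (F : set_system T) {FF : Filter F} (u : T -> X) l z :
  u t @[t --> F] --> l -> inner (u t) z @[t --> F] --> inner l z.
Proof.
move=> ul; apply/cvgrPdist_le => e e0.
have z0 : 0 < `|z| + 1 by rewrite ltr_wpDl.
move/cvgrPdist_le : ul => /(_ (e / (`|z| + 1)) (divr_gt0 e0 z0)).
apply: filterS => t ht; rewrite -innerBl; apply: le_trans (Cauchy_Schwarz _ _) _.
apply: (@le_trans _ _ (e / (`|z| + 1) * (`|z| + 1))); last by rewrite divfK ?gt_eqF.
by apply: ler_pM => //; rewrite lerDl.
Qed.

(** Completeness in the squared form in which the later estimates come; it serves both the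
    minimising sequence below and all synthesis series. *)
Lemma cauchy_sqr_cvg (u : nat -> X) :
  (forall e : R, 0 < e -> exists N, forall m n, (N <= m <= n)%N ->
     `|u n - u m| ^+ 2 <= e) -> cvgn u.
Proof.
move=> cu; apply/cauchy_cvgP/cauchy_exP => e e0.
have [N NP] := cu ((e / 2) ^+ 2) (exprn_gt0 _ (divr_gt0 e0 (ltr0Sn R 1))).
exists (u N); suff : \forall n \near \oo, ball (u N) e (u n) by [].
apply: filterS (nbhs_infty_ge N) => n /= Nn; rewrite -ball_normE /=.
have h : (N <= N <= n)%N by rewrite leqnn.
have e2 : 0 <= e / 2 by rewrite divr_ge0// ltW.
have := NP _ _ h; rewrite (ler_pXn2r (ltn0Sn 1) (normr_ge0 _) e2) => he.
by rewrite distrC (le_lt_trans he)//; lra.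
Qed.

(* The Riesz representer of f is obtained by minimising |x|^2 - 2 f(x). *)
Lemma Riesz_representation (f : X -> R) (M : R) :
  (forall x y, f (x + y) = f x + f y) -> (forall t x, f (t *: x) = t * f x) ->
  (forall x, `|f x| <= M * `|x|) -> exists z, forall x, f x = inner x z.
Proof.
move=> fD fZ fM; pose J x := `|x| ^+ 2 - 2 * f x.
have J_lb x : - M ^+ 2 <= J x.
  rewrite /J; have := fM x; have := ler_norm (f x) => h1 h2.
  have := sqr_ge0 (`|x| - M); lra.
have hasJ : has_inf (range J).
  by split; [exists (J 0), 0 | exists (- M ^+ 2) => _ [x _ <-]].
pose m := inf (range J).
have mJ x : m <= J x by apply: ge_inf; [exact: hasJ.2 | exists x].
have approx n : exists x, J x < m + n.+1%:R^-1.
  by have [|_ [x _ <-] ?] := @inf_adherent _ _ n.+1%:R^-1 _ hasJ; [|exists x].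
have [u uP] := choice approx.
(* Parallelogram law: the mean of [J x] and [J y] exceeds [J] at the midpoint by |x - y|^2 / 4.
   Hence [u] is a Cauchy sequence. *)
have dist x y : `|x - y| ^+ 2 <= 2 * (J x - m) + 2 * (J y - m).
  have := mJ (2^-1 *: (x + y)).
  rewrite /J normB_sqr fZ normrZ exprMn normD_sqr fD ger0_norm//; lra.
have cu : cvgn u.
  apply: cauchy_sqr_cvg => e e0.
  have [N _ NP] := near_infty_natSinv_lt (PosNum (divr_gt0 e0 (ltr0Sn R 3))).
  have inve n : (N <= n)%N -> n.+1%:R^-1 <= e / 4 by move=> /NP /= /ltW.
  exists N => p q /andP[Np pq]; apply: le_trans (dist _ _) _.
  have := uP p; have := uP q; have := inve p Np.
  have := inve q (leq_trans Np pq).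
  by move: (p.+1%:R^-1) (q.+1%:R^-1) => r s; lra.
exists (limn u) => x; apply/esym.
(* Moving [u n] along [x] by the best step lowers [J] by s^2 / |x|^2, where s = <u n, x> - f x.
   Since [u n] is within 1 / (n + 1) of the infimum, this bounds the drop. *)
have ufx n : (inner (u n) x - f x) ^+ 2 <= `|x| ^+ 2 * n.+1%:R^-1.
  have [->|x0] := eqVneq x 0.
    by rewrite inner0r normr0 -(scale0r (0 : X)) fZ !mul0r subrr !expr0n mul0r /=.
  have nx : 0 < `|x| ^+ 2 by rewrite exprn_gt0 ?normr_gt0.
  pose s := inner (u n) x - f x.
  have := mJ (u n - (s / `|x| ^+ 2) *: x); have := uP n.
  have -> : J (u n - (s / `|x| ^+ 2) *: x) = J (u n) - s ^+ 2 / `|x| ^+ 2.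
    have fB w t : f (w - t *: x) = f w - t * f x by rewrite -scaleNr fD fZ mulNr.
    rewrite /J normB_sqr innerZr fB normrZ exprMn real_normK ?num_real// /s.
    by field; rewrite normr_eq0.
  move=> h1 h2; have : s ^+ 2 / `|x| ^+ 2 <= n.+1%:R^-1.
    by move: (n.+1%:R^-1) h1 h2 => r; lra.
  by rewrite ler_pdivrMr// mulrC.
rewrite innerC; apply: (@cvg_unique _ _ (inner (u n) x @[n --> \oo])) => //.
  by apply: cvg_inner.
apply/cvgrPdist_le => e e0.
have nx : 0 < `|x| ^+ 2 + 1 by rewrite ltr_wpDl// sqr_ge0.
have d0 : 0 < e ^+ 2 / (`|x| ^+ 2 + 1) by rewrite divr_gt0// exprn_gt0.
apply: filterS (near_infty_natSinv_lt (PosNum d0)) => n /= /ltW hn.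
rewrite distrC -(@ler_pXn2r _ 2)// ?nnegrE// ?(ltW e0)// real_normK ?num_real//.
apply: le_trans (ufx n) _; move: hn; rewrite ler_pdivlMr// mulrC.
by apply: le_trans; apply: ler_wpM2r => //; rewrite lerDl.
Qed.

End InnerProduct.
Arguments cvg_inner {R X T F FF u l} z _.

(** * Bessel sequences *)

Section BesselSequence.
Context {R : realType} {X : hilbertType R}.
Implicit Types (x y z : X) (v : nat -> X) (c : nat -> R).

(** The upper frame bound on the synthesis side. Quantifying over blocks of indices turns it
    directly into a Cauchy estimate for partial sums. *)
Definition bessel_bound (K : R) v := forall m n c,
  `|\sum_(m <= i < n) c i *: v i| ^+ 2 <= K * \sum_(m <= i < n) c i ^+ 2.

Definition sqsum_le c (M : R) := forall N, \sum_(0 <= i < N) c i ^+ 2 <= M.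

Lemma sqsum_cat c m n : (m <= n)%N ->
  \sum_(0 <= i < n) c i ^+ 2 =
  \sum_(0 <= i < m) c i ^+ 2 + \sum_(m <= i < n) c i ^+ 2.
Proof. by move=> mn; rewrite -big_cat_nat. Qed.

Lemma sqsum_cauchy c M : sqsum_le c M ->
  forall e, 0 < e -> exists N, forall m n, (N <= m <= n)%N ->
    \sum_(m <= i < n) c i ^+ 2 <= e.
Proof.
move=> cM e e0; pose s N := \sum_(0 <= i < N) c i ^+ 2.
have hs : has_sup (range s).
  by split; [exists (s 0%N), 0%N | exists M => _ [N _ <-]; exact: cM].
have [_ [N _ <-] hN] := sup_adherent e0 hs.
exists N => m n /andP[Nm mn].
have h1 : s n <= sup (range s) by apply: ub_le_sup; [exact: hs.2 | exists n].
have : s N <= s m.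
  by rewrite /s (sqsum_cat c Nm) lerDl sumr_ge0// => i _; rewrite sqr_ge0.
have := sqsum_cat c mn; rewrite -/(s n) -/(s m); lra.
Qed.


Variables (K : R) (v : nat -> X).
Hypotheses (K0 : 0 < K) (vK : bessel_bound K v).

Lemma bessel_series_cvg c M : sqsum_le c M -> cvgn (series (fun n => c n *: v n)).
Proof.
move=> cM; apply: cauchy_sqr_cvg => e e0.
have [N NP] := sqsum_cauchy cM (divr_gt0 e0 K0).
exists N => m n /andP[Nm mn].
rewrite sub_series_geq//; apply: le_trans (vK _ _ _) _.
by rewrite -ler_pdivlMl// mulrC NP// Nm.
Qed.

Lemma synthesis_cvg c M : sqsum_le c M ->
  (\sum_(0 <= i < n) c i *: v i) @[n --> \oo] --> synthesis v c.
Proof. exact: bessel_series_cvg. Qed.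

Lemma norm_synthesis c M : sqsum_le c M -> `|synthesis v c| ^+ 2 <= K * M.
Proof.
move=> cM.
have h : `|\sum_(0 <= i < n) c i *: v i| ^+ 2 @[n --> \oo] --> `|synthesis v c| ^+ 2.
  have /cvg_norm h := synthesis_cvg cM.
  by rewrite expr2; under eq_fun do rewrite expr2; exact: cvgM.
rewrite -(cvg_lim _ h)//; apply: limr_le; first by apply/cvg_ex; eexists; exact: h.
by near=> n; apply: le_trans (vK _ _ _) _; rewrite ler_pM2l//.
Unshelve. all: by end_near. Qed.

Lemma inner_synthesis c M x : sqsum_le c M ->
  (\sum_(0 <= i < n) c i * inner (v i) x) @[n --> \oo] --> inner (synthesis v c) x.
Proof.
move=> cM; rewrite (_ : (fun n => _) = fun n => inner (\sum_(0 <= i < n) c i *: v i) x).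
  exact: cvg_inner (synthesis_cvg cM).
apply/funext => n; rewrite inner_suml; apply: eq_bigr => i _.
by rewrite innerZl.
Qed.

Lemma synthesisD c M d N : sqsum_le c M -> sqsum_le d N ->
  synthesis v (fun n => c n + d n) = synthesis v c + synthesis v d.
Proof.
move=> cM dN; apply: cvg_lim => //; rewrite /series /=.
under eq_fun do (under eq_bigr do rewrite scalerDl; rewrite big_split).
by apply: cvgD; [exact: synthesis_cvg cM | exact: synthesis_cvg dN].
Qed.

Lemma synthesisZ t c M : sqsum_le c M ->
  synthesis v (fun n => t * c n) = t *: synthesis v c.
Proof.
move=> cM; apply: cvg_lim => //; rewrite /series /=.
under eq_fun do (under eq_bigr do rewrite -scalerA; rewrite -scaler_sumr).
by apply: cvgZr; exact: synthesis_cvg cM.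
Qed.

Lemma sqsum_leZ t c M : sqsum_le c M -> sqsum_le (fun n => t * c n) (t ^+ 2 * M).
Proof.
move=> cM N; under eq_bigr do rewrite exprMn.
by rewrite -mulr_sumr ler_wpM2l// sqr_ge0.
Qed.

Lemma synthesisB c M d N : sqsum_le c M -> sqsum_le d N ->
  synthesis v (fun n => c n - d n) = synthesis v c - synthesis v d.
Proof.
move=> cM dN; rewrite -scaleN1r -(synthesisZ _ dN).
rewrite -(synthesisD cM (sqsum_leZ (-1) dN)).
by congr synthesis; apply/funext => n; rewrite mulN1r.
Qed.

(** Duality between synthesis and analysis: with s the partial sum of <x, v_i> v_i, one has <s, x> =
    T, the sum of squares, and |s|^2 <= K T. Expanding |K x - s|^2 >= 0 then gives T <= K |x|^2. *)
Lemma bessel_sqsum x : sqsum_le (analysis v x) (K * `|x| ^+ 2).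
Proof.
move=> N; pose c := analysis v x; pose s := \sum_(0 <= i < N) c i *: v i.
have sx : inner s x = \sum_(0 <= i < N) c i ^+ 2.
  by rewrite /s inner_suml; apply: eq_bigr => i _; rewrite innerZl innerC expr2.
have := vK 0 N c; rewrite -/s -sx => h1.
have := sqr_ge0 `|K *: x - s|.
rewrite normB_sqr normrZ exprMn real_normK ?num_real// innerZl innerC => h2.
rewrite -(ler_pM2l K0); lra.
Qed.

End BesselSequence.
Arguments inner_synthesis {R X K v} K0 vK {c M} x _.

(** * Frames and dual frames *)

(** Passage between the extended-real series of the definitions and the bounds on finite partial
    sums used in the proofs. *)
Lemma nneseries_leP {R : realType} (u : nat -> R) (M : R) :
  (forall n, 0 <= u n) ->
  (\sum_(0 <= n <oo) (u n)%:E <= M%:E)%E <->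
  forall N, \sum_(0 <= i < N) u i <= M.
Proof.
move=> u0; split=> [h N|h].
  rewrite -lee_fin; apply: le_trans h; rewrite -sumEFin.
  by apply: nneseries_lim_ge => n _ _; rewrite lee_fin.
apply: lime_le; first by apply: is_cvg_nneseries => n _ _; rewrite lee_fin.
by near=> N; rewrite sumEFin lee_fin.
Unshelve. all: by end_near. Qed.

Section Subspace.
Context {R : realType} {X : hilbertType R}.
Implicit Types (Z : set X) (x y : X).

Definition linear_subspace Z :=
  [/\ Z 0, (forall x y, Z x -> Z y -> Z (x + y)) &
      forall (t : R) x, Z x -> Z (t *: x)].

Lemma subspaceB Z x y : linear_subspace Z -> Z x -> Z y -> Z (x - y).
Proof. by move=> [_ ZD ZZ] Zx Zy; rewrite -scaleN1r; apply: ZD => //; exact: ZZ. Qed.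

Lemma subspace_sum Z (v : nat -> X) (c : nat -> R) m n : linear_subspace Z ->
  (forall i, Z (v i)) -> Z (\sum_(m <= i < n) c i *: v i).
Proof.
by move=> [Z0 ZD ZZ] Zv; elim/big_ind: _ => // i _; exact: ZZ.
Qed.

Lemma subspace_orth (S : set X) : linear_subspace (orth S).
Proof.
split=> [z _|x y Sx Sy z Sz|t x Sx z Sz]; first exact: inner0l.
- by rewrite innerDl Sx// Sy// addr0.
- by rewrite innerZl Sx// mulr0.
Qed.

Lemma closed_orth (S : set X) : closed (orth S).
Proof.
have -> : orth S = \bigcap_(z in S) ((fun x => inner x z) @^-1` [set 0]).
  by apply/seteqP; split => x h z Sz; exact: h.
apply: closed_bigI => z Sz; apply: preimage_closed; last exact: closed_eq.
by move=> x _; exact: (cvg_inner z).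
Qed.

Lemma closureP Z x : closure Z x <->
  forall e : R, 0 < e -> exists2 y, Z y & `|x - y| < e.
Proof.
split=> [cZ e e0|h B /nbhs_ballP[e /= e0 eB]].
  have [y [Zy]] := cZ _ (nbhsx_ballx x e e0).
  by rewrite -ball_normE /= => xy; exists y.
by have [y Zy xy] := h e e0; exists y; split => //; apply: eB; rewrite -ball_normE.
Qed.

Lemma subspace_closure Z : linear_subspace Z -> linear_subspace (closure Z).
Proof.
move=> [Z0 ZD ZZ]; split=> [|x y /closureP cx /closureP cy|t x /closureP cx].
- exact: subset_closure.
- apply/closureP => e e0; have e2 : 0 < e / 2 by rewrite divr_gt0.
  have [x' Zx xx] := cx _ e2; have [y' Zy yy] := cy _ e2.
  exists (x' + y'); first exact: ZD.
  rewrite opprD addrACA (splitr e).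
  by apply: le_lt_trans (ler_normD _ _) _; rewrite ltrD.
- apply/closureP => e e0; have t0 : 0 < `|t| + 1 by rewrite ltr_wpDl.
  have [y Zy xy] := cx _ (divr_gt0 e0 t0); exists (t *: y); first exact: ZZ.
  rewrite -scalerBr normrZ; move: xy; rewrite ltr_pdivlMr// mulrC.
  by apply: le_lt_trans; apply: ler_wpM2r => //; rewrite lerDl.
Qed.

End Subspace.

Section Frame.
Context {R : realType} {X : hilbertType R}.
Variables (phi : nat -> X) (Z : set X).
Hypothesis subZ : linear_subspace Z.

(** The upper frame inequality is applied to s, the sum of c_i phi_i, which lies in [Z]: the sum of
    <s, phi_i>^2 is at most b |s|^2. Expanding the sum of (b c_i - <s, phi_i>)^2 >= 0 turns this
    into |s|^2 <= b times the sum of c_i^2. The resulting Bessel bound controls the coefficients of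
    every vector of [X], not only of those in [Z]. *)
Lemma frame_bounds : is_frame phi Z -> exists a b : R,
  [/\ 0 < a, 0 < b, bessel_bound b phi &
      forall x M, Z x -> sqsum_le (analysis phi x) M -> a * `|x| ^+ 2 <= M].
Proof.
move=> [Zphi [a [b [/andP[a0 ab] h]]]]; exists a, b.
have b0 : 0 < b by exact: lt_le_trans ab.
have sq0 x n : 0 <= inner x (phi n) ^+ 2 by rewrite sqr_ge0.
split=> // [m n c|x M Zx xM]; last first.
  by rewrite -lee_fin; apply: le_trans (h _ Zx).1 _; exact/nneseries_leP.
pose s := \sum_(m <= i < n) c i *: phi i.
have Zs : Z s by exact: subspace_sum.
have /(nneseries_leP _ (sq0 s)) hs := (h _ Zs).2.
have sums : \sum_(m <= i < n) inner s (phi i) ^+ 2 <= b * `|s| ^+ 2.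
  have [mn|nm] := leqP m n; last first.
    by rewrite big_geq ?(ltnW nm)// mulr_ge0// ltW.
  apply: le_trans (hs n).
  by rewrite (sqsum_cat (analysis phi s) mn) lerDr;
    apply: sumr_ge0 => i _; rewrite sqr_ge0.
have : \sum_(m <= i < n) (b * c i - inner s (phi i)) ^+ 2 >= 0.
  by apply: sumr_ge0 => i _; rewrite sqr_ge0.
have -> : \sum_(m <= i < n) (b * c i - inner s (phi i)) ^+ 2 =
    b ^+ 2 * \sum_(m <= i < n) c i ^+ 2 - 2 * b * `|s| ^+ 2
    + \sum_(m <= i < n) inner s (phi i) ^+ 2.
  have -> : `|s| ^+ 2 = \sum_(m <= i < n) c i * inner s (phi i).
    rewrite -inner_norm {1}/s inner_suml; apply: eq_bigr => i _.
    by rewrite innerZl innerC.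
  rewrite !mulr_sumr -sumrB -big_split /=; apply: eq_bigr => i _; ring.
rewrite -/s => h2; rewrite -(ler_pM2l b0).
move: (\sum_(m <= i < n) c i ^+ 2) (\sum_(m <= i < n) inner s (phi i) ^+ 2)
  sums h2 => C S; nra.
Qed.

Variables a b : R.
Hypotheses (a0 : 0 < a) (b0 : 0 < b) (closedZ : closed Z)
  (Zphi : forall n, Z (phi n)) (phib : bessel_bound b phi)
  (phia : forall x M, Z x -> sqsum_le (analysis phi x) M -> a * `|x| ^+ 2 <= M).

Lemma subspace_synthesis (v : nat -> X) (c : nat -> R) :
  (forall n, Z (v n)) -> cvgn (series (fun n => c n *: v n)) ->
  Z (synthesis v c).
Proof.
move=> Zv cv; apply: (closed_cvg Z closedZ _ _ cv).
by apply: nearW => n; exact: subspace_sum.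
Qed.

Local Notation S := (frame_operator phi).

Lemma analysis_sqsum x : sqsum_le (analysis phi x) (b * `|x| ^+ 2).
Proof. exact: bessel_sqsum. Qed.

Lemma frame_operator_in x : Z (S x).
Proof.
apply: subspace_synthesis => //.
exact: (bessel_series_cvg b0 phib (analysis_sqsum x)).
Qed.

Lemma frame_operatorD x y : S (x + y) = S x + S y.
Proof.
rewrite /frame_operator -(synthesisD b0 phib (analysis_sqsum x) (analysis_sqsum y)).
by congr synthesis; apply/funext => n; rewrite /analysis innerDl.
Qed.

Lemma frame_operatorZ t x : S (t *: x) = t *: S x.
Proof.
rewrite /frame_operator -(synthesisZ b0 phib t (analysis_sqsum x)).
by congr synthesis; apply/funext => n; rewrite /analysis innerZl.
Qed.

Lemma frame_operatorB x y : S (x - y) = S x - S y.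
Proof. by rewrite -scaleN1r frame_operatorD frame_operatorZ scaleN1r. Qed.

Lemma cvg_frame_operator x y :
  (\sum_(0 <= i < n) inner x (phi i) * inner (phi i) y) @[n --> \oo]
    --> inner (S x) y.
Proof. exact: (inner_synthesis b0 phib y (analysis_sqsum x)). Qed.

(** Both sides are limits of the same partial sums of <x, phi_i> <phi_i, y>. *)
Lemma frame_operator_sym x y : inner (S x) y = inner x (S y).
Proof.
rewrite (innerC x); apply: (cvg_unique _ (@cvg_frame_operator x y)) => //.
rewrite (_ : (fun n => _) =
  fun n => \sum_(0 <= i < n) inner y (phi i) * inner (phi i) x).
  exact: cvg_frame_operator.
by apply/funext => n; apply: eq_bigr => i _; rewrite mulrC innerC (innerC x).
Qed.

Lemma frame_operator_lb x : Z x -> a * `|x| ^+ 2 <= inner (S x) x.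
Proof.
move=> Zx; apply: phia => // N.
have h : (\sum_(0 <= i < n) analysis phi x i ^+ 2) @[n --> \oo] --> inner (S x) x.
  rewrite (_ : (fun n => _) =
    fun n => \sum_(0 <= i < n) inner x (phi i) * inner (phi i) x).
    exact: cvg_frame_operator.
  by apply/funext => n; apply: eq_bigr => i _; rewrite (innerC _ x) expr2.
rewrite -(cvg_lim _ h)//; apply: nondecreasing_cvgn_le.
  move=> m n mn; rewrite (sqsum_cat _ mn) lerDl sumr_ge0// => i _.
  by rewrite sqr_ge0.
by apply/cvg_ex; eexists; exact: h.
Qed.

Lemma norm_frame_operator x : `|S x| ^+ 2 <= b ^+ 2 * `|x| ^+ 2.
Proof.
by have := norm_synthesis b0 phib (analysis_sqsum x); rewrite mulrA -expr2.
Qed.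

(** Expand |S x - a x|^2 >= 0 and use a <S x, x> >= a^2 |x|^2. *)
Lemma norm_frame_operator_ge x : Z x -> a ^+ 2 * `|x| ^+ 2 <= `|S x| ^+ 2.
Proof.
move=> Zx; have := ler_wpM2l (ltW a0) (frame_operator_lb Zx).
have := sqr_ge0 `|S x - a *: x|.
rewrite normB_sqr innerZr normrZ exprMn real_normK ?num_real//.
move: (inner (S x) x) (`|x| ^+ 2) (`|S x| ^+ 2) => s q r; lra.
Qed.

(* With step a / b^2 the relaxed iteration z - t (S z - y) contracts:
   |h - t S h|^2 <= (1 - a^2 / b^2) |h|^2. *)
Lemma frame_operator_surj y : Z y -> exists2 z, Z z & S z = y.
Proof.
move=> Zy; pose t := a / b ^+ 2.
have t0 : 0 < t by rewrite divr_gt0// exprn_gt0.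
pose f (z : X) : X := z - t *: (S z - y).
have fZ : set_fun Z Z f.
  move=> z Zz; apply: subspaceB => //; have [_ _ ZZ] := subZ.
  apply: ZZ; apply: subspaceB => //; exact: frame_operator_in.
pose q2 := 1 - a ^+ 2 / b ^+ 2.
have contr x : Z x -> `|x - t *: S x| ^+ 2 <= q2 * `|x| ^+ 2.
  move=> Zx; rewrite normB_sqr innerZr normrZ exprMn real_normK ?num_real//.
  have := frame_operator_lb Zx; have := norm_frame_operator x.
  rewrite (innerC _ x).
  move: (inner x (S x)) (`|S x| ^+ 2) (`|x| ^+ 2) => s r q h1 h2.
  have -> : q2 * q = q - 2 * (t * (a * q)) + t ^+ 2 * (b ^+ 2 * q).
    by rewrite /q2 /t; field; rewrite gt_eqF.
  apply: lerD; last by rewrite ler_wpM2l// sqr_ge0.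
  rewrite lerD2l lerN2 ler_pM2l// ler_pM2l//.
have ctrf : is_contraction (mkfun_fun fZ).
  (* The contraction constant is the root of [q2] because [contr] bounds squares. [Num.sqrt] is 0 on
     negative reals, which settles the case [q2 < 0]. *)
  exists (NngNum (sqrtr_ge0 q2)); split => /=.
    rewrite -[ltRHS]sqrtr1 ltr_sqrt// /q2 ltrBlDr ltrDl divr_gt0// exprn_gt0//.
  move=> [x x'] [/= Zx Zx'].
  have -> : mkfun_fun fZ x - mkfun_fun fZ x' = (x - x') - t *: S (x - x').
    have -> : S (x - x') = (S x - y) - (S x' - y).
      by rewrite frame_operatorB opprB addrA subrK.
    by rewrite scalerBr !opprB addrACA [RHS]addrACA (addrC (- x')).
  rewrite -(@ler_pXn2r _ 2)// ?nnegrE ?mulr_ge0 ?sqrtr_ge0// exprMn.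
  apply: le_trans (contr _ (subspaceB subZ Zx Zx')) _.
  apply: ler_wpM2r; first by rewrite sqr_ge0.
  have [q0|q0] := leP 0 q2; first by rewrite sqr_sqrtr.
  by apply: le_trans (ltW q0) _; rewrite sqr_ge0.
have [|p Zp] := banach_fixed_point ctrf closedZ; first by exists y.
rewrite /= /f => pf; exists p => //; apply/eqP; rewrite -subr_eq0.
move/eqP: pf; rewrite -subr_eq0 opprB addrC subrK scaler_eq0 gt_eqF//.
Qed.

Local Notation dual := (dual_frame Z phi).

(** Surjectivity of [S] on [Z] provides the witness that keeps [xget] from its default value. *)
Lemma dual_frameP n : Z (dual n) /\ S (dual n) = phi n.
Proof.
have [z Zz Sz] := frame_operator_surj (Zphi n).
exact: (@xgetPex _ 0 [set z | Z z /\ S z = phi n]) (ex_intro _ z (conj Zz Sz)).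
Qed.

Lemma frame_operator_sum (c : nat -> R) m n :
  S (\sum_(m <= i < n) c i *: dual i) = \sum_(m <= i < n) c i *: phi i.
Proof.
elim/big_rec2: _ => [|i x y _ <-].
  by rewrite -(scale0r (0 : X)) frame_operatorZ !scale0r.
by rewrite frame_operatorD frame_operatorZ (dual_frameP i).2.
Qed.

(** [S] sends a combination of dual vectors to the same combination of the phi_i, and it is bounded
    below by [a] on [Z]; hence the division by a^2. *)
Lemma dual_frame_bessel : bessel_bound (b / a ^+ 2) dual.
Proof.
move=> m n c; have := phib m n c; rewrite -frame_operator_sum => h.
have Zs : Z (\sum_(m <= i < n) c i *: dual i).
  by apply: subspace_sum => // i; exact: (dual_frameP i).1.
have := norm_frame_operator_ge Zs => h2.
rewrite mulrAC ler_pdivlMr ?exprn_gt0// mulrC; exact: le_trans h2 h.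
Qed.

(** The synthesised vector is the orthogonal projection of [x] onto [Z]. By symmetry of [S],
    <dual_i, phi_n> = <phi_i, dual_n>, so its n-th coefficient is <S x, dual_n> = <x, phi_n>. *)
Lemma dual_frame_reconstruct x :
  Z (synthesis dual (analysis phi x)) /\
  forall n, inner (synthesis dual (analysis phi x)) (phi n) = inner x (phi n).
Proof.
have K0 : 0 < b / a ^+ 2 by rewrite divr_gt0// exprn_gt0.
have cvs := bessel_series_cvg K0 dual_frame_bessel (analysis_sqsum x).
split=> [|n].
  by apply: subspace_synthesis => // n; exact: (dual_frameP n).1.
have -> : inner x (phi n) = inner (S x) (dual n).
  by rewrite frame_operator_sym (dual_frameP n).2.
have h := inner_synthesis K0 dual_frame_bessel (phi n) (analysis_sqsum x).
apply: (cvg_unique _ h) => //.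
rewrite (_ : (fun n => _) = fun k =>
  \sum_(0 <= i < k) inner x (phi i) * inner (phi i) (dual n)).
  exact: cvg_frame_operator.
apply/funext => k; apply: eq_bigr => i _; congr (_ * _).
by rewrite -{1}(dual_frameP n).2 -frame_operator_sym (dual_frameP i).2.
Qed.

End Frame.

(** * Diagonal frame decompositions *)

Section DiagonalFrameDecomposition.
Context {R : realType} {X Y : hilbertType R}.
Variables (A : {linear X -> Y}) (phi : nat -> X) (psi : nat -> Y).
Variable kappa : nat -> R.
Hypotheses (compact_A : compact_operator A)
  (dfd : diagonal_frame_decomposition A phi psi kappa).

(** The image of the unit ball lies in a compact, hence bounded, set; the rest is scaling.
    Boundedness is what Riesz representation requires for the adjoint to exist. *)
Lemma compact_operator_bounded : exists M : R, forall x, `|A x| <= M * `|x|.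
Proof.
have bB : bounded_set [set x : X | `|x| <= 1].
  by exists 1; split; [exact: num_real | move=> M M1 x /= /le_trans; apply; exact: ltW].
have [U BU [cU _]] := compact_A bB.
have [M [_ MU]] := compact_bounded cU.
have {MU}MU x : `|x| <= 1 -> `|A x| <= M + 1.
  by move=> x1; apply: (MU (M + 1)); [rewrite ltrDl | apply: BU; exists x].
exists (M + 1) => x; have [->|x0] := eqVneq x 0.
  by rewrite linear0 !normr0 mulr0.
have nx : 0 < `|x| by rewrite normr_gt0.
have := MU (`|x|^-1 *: x).
rewrite linearZ !normrZ normfV normr_id mulVf ?gt_eqF// => /(_ (lexx _)).
by rewrite mulrC ler_pdivrMr.
Qed.

(** Riesz representation shows that the set in [adjoint] is nonempty, so the chosen value kappa_n
    phi_n has the defining property of the adjoint. *)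
Lemma dfd_adjoint x n : inner (A x) (psi n) = kappa n * inner x (phi n).
Proof.
have [_ _ _ adj] := dfd; have [M AM] := compact_operator_bounded.
rewrite -innerZr -adj.
have [||y|z zP] := @Riesz_representation _ _ (fun y => inner (A y) (psi n))
  (M * `|psi n|).
- by move=> y z; rewrite linearD innerDl.
- by move=> t y; rewrite linearZ innerZl.
- rewrite mulrAC; apply: le_trans (Cauchy_Schwarz _ _) _.
  by apply: ler_wpM2r.
exact: (@xgetPex _ 0 [set z | forall x, inner (A x) (psi n) = inner x z])
  (ex_intro _ z zP) x.
Qed.

Let subK := subspace_orth (Defs.kernel A).

Lemma subspace_range : linear_subspace (range A).
Proof.
split=> [|_ _ [x _ <-] [y _ <-]|t _ [x _ <-]]; first by exists 0; rewrite ?linear0.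
- by exists (x + y); rewrite ?linearD.
- by exists (t *: x); rewrite ?linearZ.
Qed.

(** All coefficients <A x, psi_n> = kappa_n <x, phi_n> vanish, and the lower frame bound of [psi]
    forces A x = 0. *)
Lemma dfd_kernel x : (forall n, inner x (phi n) = 0) -> A x = 0.
Proof.
have [_ psi_frame _ _] := dfd => x0.
have [a [b [a0 _ _ lb]]] := frame_bounds (subspace_closure subspace_range) psi_frame.
have : a * `|A x| ^+ 2 <= 0.
  apply: lb; first by apply: subset_closure; exists x.
  by move=> N; rewrite big1// => i _; rewrite /analysis dfd_adjoint x0 mulr0 expr0n.
rewrite pmulr_rle0// => h; apply/eqP; rewrite -normr_eq0 -sqrf_eq0.
by rewrite eq_le h sqr_ge0.
Qed.

(** The projection [u] satisfies the conditions defining the pseudo-inverse, and they determine it: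
    for the chosen [z], A x - A z lies in the range and is orthogonal to it, then z - u lies in the
    kernel and is orthogonal to it. *)
Lemma dfd_pseudo_inverse x :
  pseudo_inverse A (A x) =
  synthesis (dual_frame (orth (Defs.kernel A)) phi) (analysis phi x).
Proof.
have [[phiZ phiab] _ _ _] := dfd.
have [a [b [a0 b0 phib phia]]] := frame_bounds subK (conj phiZ phiab).
have [Zu uphi] := dual_frame_reconstruct subK a0 b0 (@closed_orth _ _ _) phiZ phib phia x.
set u := synthesis _ _ in Zu uphi *.
have Au : A u = A x.
  apply/eqP; rewrite -subr_eq0 -linearB; apply/eqP; apply: dfd_kernel => n.
  by rewrite innerBl uphi subrr.
have P : exists z, orth (Defs.kernel A) z /\ orth (range A) (A x - A z).
  by exists u; split => // z _; rewrite Au subrr inner0l.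
have := xgetPex 0 P; rewrite -/(pseudo_inverse A (A x)).
set z := pseudo_inverse A (A x) => -[Zz zA].
have Az : A z = A x.
  apply/eqP; rewrite eq_sym -subr_eq0 -normr_eq0 -sqrf_eq0 -inner_norm.
  by rewrite zA//; exists (x - z); rewrite ?linearB.
apply/eqP; rewrite -subr_eq0 -normr_eq0 -sqrf_eq0 -inner_norm.
rewrite (subspaceB subK Zz Zu)// /Defs.kernel /= linearB Az Au subrr//.
Qed.

Lemma dfd_bessel : exists2 b : R, 0 < b &
  forall x N, \sum_(0 <= i < N) inner x (phi i) ^+ 2 <= b * `|x| ^+ 2.
Proof.
have [phi_frame _ _ _] := dfd.
have [a [b [_ b0 phib _]]] := frame_bounds subK phi_frame.
by exists b => // x; exact: (bessel_sqsum b0 phib).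
Qed.

Lemma dual_frame_synthesis_bound : exists2 K : R, 0 < K &
  bessel_bound K (dual_frame (orth (Defs.kernel A)) phi).
Proof.
have [[phiZ phiab] _ _ _] := dfd.
have [a [b [a0 b0 phib phia]]] := frame_bounds subK (conj phiZ phiab).
exists (b / a ^+ 2); first by rewrite divr_gt0// exprn_gt0.
exact: (dual_frame_bessel subK a0 b0 (@closed_orth _ _ _)).
Qed.

Lemma reconstruction_error : exists2 K : R, 0 < K &
  forall (g e : nat -> R) (x : X),
  ((`|pseudo_inverse A (A x)
      - coef_reg A phi g (fun n => analysis psi (A x) n + e n)| ^+ 2)%:E <=
   K%:E * \sum_(0 <= n <oo)
     (((1 - g n * kappa n) * inner x (phi n) - g n * e n) ^+ 2)%:E)%E.
Proof.
have [K K0 dualK] := dual_frame_synthesis_bound.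
have [b b0 phib] := dfd_bessel.
exists K => // g e x; rewrite dfd_pseudo_inverse /coef_reg.
pose d n := (1 - g n * kappa n) * inner x (phi n) - g n * e n.
have d0 n : 0 <= d n ^+ 2 by rewrite sqr_ge0.
have : (0 <= \sum_(0 <= n <oo) (d n ^+ 2)%:E)%E.
  by apply: nneseries_ge0 => n _ _; rewrite lee_fin.
(* An infinite series leaves nothing to prove since [K] is positive. A finite one makes [d]
   square-summable, and only this gives convergence of the synthesis of the filtered noisy data, for
   which [g] and [e] are arbitrary. *)
case S : (\sum_(0 <= n <oo) (d n ^+ 2)%:E)%E => [M| |] // _; last first.
  by rewrite gt0_muley ?lte_fin// leey.
have dM : sqsum_le d M by apply/(nneseries_leP _ d0); rewrite S.
have -> : synthesis (dual_frame (orth (Defs.kernel A)) phi)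
      (fun n => g n * (analysis psi (A x) n + e n)) =
    synthesis (dual_frame (orth (Defs.kernel A)) phi) (fun n => analysis phi x n - d n).
  congr synthesis; apply/funext => n.
  by rewrite /d /analysis dfd_adjoint; ring.
rewrite (synthesisB K0 dualK (phib x) dM) opprB addrC subrK.
by rewrite -EFinM lee_fin; exact: (norm_synthesis K0 dualK dM).
Qed.

(** A bounded filter preserves square-summability, so the map is linear and bounded, hence
    Lipschitz. *)
Lemma coef_reg_continuous (g : nat -> R) (G : R) : (forall n, `|g n| <= G) ->
  continuous (fun y : Y => coef_reg A phi g (analysis psi y)).
Proof.
move=> gG; have [_ psi_frame _ _] := dfd.
have [_ [b [_ b0 psib _]]] :=
  frame_bounds (subspace_closure subspace_range) psi_frame.
have [K K0 dualK] := dual_frame_synthesis_bound.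
have sq y : sqsum_le (fun n => g n * analysis psi y n) (G ^+ 2 * (b * `|y| ^+ 2)).
  move=> N; apply: le_trans (ler_wpM2l (sqr_ge0 G) (bessel_sqsum b0 psib y N)).
  rewrite mulr_sumr; apply: ler_sum => i _; rewrite exprMn ler_wpM2r ?sqr_ge0//.
  rewrite -[g i ^+ 2]real_normK ?num_real// ler_pXn2r ?nnegrE//.
  exact: le_trans (gG i).
have lip y z :
    `|coef_reg A phi g (analysis psi y) - coef_reg A phi g (analysis psi z)| ^+ 2
    <= K * (G ^+ 2 * b) * `|y - z| ^+ 2.
  rewrite /coef_reg -(synthesisB K0 dualK (sq y) (sq z)).
  have -> : K * (G ^+ 2 * b) * `|y - z| ^+ 2 = K * (G ^+ 2 * (b * `|y - z| ^+ 2)) by ring.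
  rewrite (_ : (fun n => _) = fun n => g n * analysis psi (y - z) n).
    exact: (norm_synthesis K0 dualK (sq (y - z))).
  by apply/funext => n; rewrite /analysis innerBl mulrBr.
set L := K * (G ^+ 2 * b) in lip.
(* [L] vanishes when [G] is 0; adding 1 allows the division below. *)
have L0 : 0 < L + 1.
  by rewrite ltr_wpDl// mulr_ge0 ?(ltW K0)// mulr_ge0 ?(ltW b0)// sqr_ge0.
move=> y; apply/cvgrPdist_le => e e0.
have d0 : 0 < Num.sqrt (e ^+ 2 / (L + 1)) by rewrite sqrtr_gt0 divr_gt0// exprn_gt0.
near=> z.
rewrite -(@ler_pXn2r _ 2)// ?nnegrE// ?(ltW e0)//; apply: le_trans (lip _ _) _.
have : `|y - z| <= Num.sqrt (e ^+ 2 / (L + 1)).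
  near: z; apply: filterS (nbhsx_ballx y _ d0) => z.
  by rewrite -ball_normE /= => /ltW.
rewrite -(@ler_pXn2r _ 2)// ?nnegrE// ?(ltW d0)// sqr_sqrtr; last first.
  by rewrite divr_ge0 ?sqr_ge0// ltW.
rewrite ler_pdivlMr// mulrC; apply: le_trans.
by rewrite ler_wpM2r ?sqr_ge0// lerDl.
Unshelve. all: by end_near. Qed.

End DiagonalFrameDecomposition.

(** * Integrals over the product of the signal and noise spaces *)

(* f need not be measurable: the squared error involves limn, whose value at
   divergent sequences is arbitrary. *)
Lemma le_integral_ge0 d (T : measurableType d) (R : realType)
    (mu : {measure set T -> \bar R}) (f h : T -> \bar R) :
  (forall x, 0 <= f x)%E -> (forall x, f x <= h x)%E ->
  (\int[mu]_x f x <= \int[mu]_x h x)%E.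
Proof.
move=> f0 fh; have h0 x : (0 <= h x)%E by exact: le_trans (f0 x) (fh x).
rewrite !ge0_integralTE//; apply: le_ereal_sup => _ [s sf <-].
by exists s => // x; exact: le_trans (sf x) (fh x).
Qed.

Lemma continuous_borel_measurable (R : realType) (X : hilbertType R) (f : X -> R) :
  continuous f -> measurable_fun [set: borel X] (f : borel X -> R).
Proof.
move=> /continuousP cf; apply: (measurability _ (RGenOpens.measurableE R)).
move=> _ [_ [a [b ->]] <-]; rewrite setTI.
by apply: sub_sigma_algebra; apply: cf; exact: interval_open.
Qed.

Lemma coordinate_measurable (R : realType) (n : nat) :
  measurable_fun [set: coef_space R] (fun e : coef_space R => e n).
Proof.
move=> _ B mB; rewrite setTI; apply: sub_sigma_algebra.
by exists n => //; exists B => //; rewrite setTI.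
Qed.

Section ProductIntegral.
Context d1 d2 (T1 : measurableType d1) (T2 : measurableType d2) (R : realType).
Variables (P1 : probability T1 R) (P2 : probability T2 R).

Lemma integral_prod_fst (f : T1 -> \bar R) : measurable_fun setT f ->
  (forall x, 0 <= f x)%E ->
  (\int[P1 \x P2]_w f w.1 = \int[P1]_x f x)%E.
Proof.
move=> mf f0; rewrite (fubini_tonelli1 (fun w : T1 * T2 => f w.1))//; last first.
  exact: (measurableT_comp mf measurable_fst).
apply: eq_integral => x _; rewrite /fubini_F /=.
by rewrite (integral_cst P2 measurableT (f x))
  [X in (_ * X)%E](@probability_setT _ _ _ P2) mule1.
Qed.

Lemma integral_prod_snd (f : T2 -> \bar R) : measurable_fun setT f ->
  (forall x, 0 <= f x)%E ->
  (\int[P1 \x P2]_w f w.2 = \int[P2]_x f x)%E.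
Proof.
move=> mf f0; rewrite (fubini_tonelli2 (fun w : T1 * T2 => f w.2))//; last first.
  exact: (measurableT_comp mf measurable_snd).
apply: eq_integral => x _; rewrite /fubini_G /=.
by rewrite (integral_cst P1 measurableT (f x))
  [X in (_ * X)%E](@probability_setT _ _ _ P1) mule1.
Qed.

End ProductIntegral.

(** * The mean squared error of the optimal filter *)

Section MeanSquaredError.
Context {R : realType} {X Y : hilbertType R}.
Variables (A : {linear X -> Y}) (phi : nat -> X) (psi : nat -> Y).
Variables (kappa : nat -> R) (Px : probability (borel X) R).
Hypotheses (compact_A : compact_operator A)
  (second_moment : (\int[Px]_x (`|(x : X)| ^+ 2)%:E < +oo)%E)
  (dfd : diagonal_frame_decomposition A phi psi kappa).

Local Notation Pi := (signal_var phi Px).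

Lemma measurable_inner (z : X) :
  measurable_fun [set: borel X] (fun x : borel X => inner (x : X) z).
Proof.
by apply: continuous_borel_measurable => x; exact: (cvg_inner z).
Qed.

Lemma measurable_inner_sqr (z : X) :
  measurable_fun [set: borel X] (fun x : borel X => (inner (x : X) z ^+ 2)%:E).
Proof. by apply/measurable_EFinP; apply: measurable_funX; exact: measurable_inner. Qed.

Lemma signal_var_ge0 n : 0 <= Pi n.
Proof.
rewrite /signal_var unlock; apply/fine_ge0/integral_ge0 => x _.
by rewrite lee_fin sqr_ge0.
Qed.

Lemma noise_var_ge0 (P : noise_law R) n : 0 <= noise_var P n.
Proof.
rewrite /noise_var unlock; apply/fine_ge0/integral_ge0 => x _.
by rewrite lee_fin sqr_ge0.
Qed.

(** Exchange sum and integral by nonnegativity; the upper frame bound then dominates the integrand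
    by b |x|^2, which has finite expectation. *)
Lemma integral_inner_sqr_summable : exists M : R,
  (\sum_(0 <= n <oo) \int[Px]_x (inner (x : X) (phi n) ^+ 2)%:E <= M%:E)%E.
Proof.
have [b b0 phib] := dfd_bessel dfd.
have mn : measurable_fun [set: borel X] (fun x : borel X => (`|x : X| ^+ 2)%:E).
  apply/measurable_EFinP; apply: measurable_funX.
  by apply: continuous_borel_measurable => x; exact: norm_continuous.
have fin : (\int[Px]_x (`|(x : X)| ^+ 2)%:E)%E \is a fin_num.
  by rewrite ge0_fin_numE//; apply: integral_ge0 => x _; rewrite lee_fin sqr_ge0.
exists (b * fine (\int[Px]_x (`|(x : X)| ^+ 2)%:E)%E).
rewrite EFinM fineK// -(ge0_integralZl_EFin _ _ _ mn) ?(ltW b0)//.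
rewrite -(integral_nneseries _ measurableT); first last.
- by move=> n x _; rewrite lee_fin sqr_ge0.
- by move=> n; exact: measurable_inner_sqr.
apply: le_integral_ge0 => x.
  by apply: nneseries_ge0 => n _ _; rewrite lee_fin sqr_ge0.
rewrite -EFinM; apply/nneseries_leP => [n|N]; first by rewrite sqr_ge0.
exact: phib.
Qed.

(** Each expectation is at most the finite sum of all of them, so [fine] loses nothing. *)
Lemma signal_varE n :
  (\int[Px]_x (inner (x : X) (phi n) ^+ 2)%:E = (Pi n)%:E)%E.
Proof.
have [M hM] := integral_inner_sqr_summable.
have i0 k : (0 <= \int[Px]_x (inner (x : X) (phi k) ^+ 2)%:E)%E.
  by apply: integral_ge0 => x _; rewrite lee_fin sqr_ge0.
rewrite /signal_var unlock fineK// ge0_fin_numE//.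
apply: (@le_lt_trans _ _ M%:E); last by rewrite ltry.
apply: le_trans hM; apply: le_trans (nneseries_lim_ge n.+1 _) => //.
by rewrite big_nat_recr//= leeDr// sume_ge0.
Qed.

Lemma signal_var_summable : exists M : R, forall N, \sum_(0 <= i < N) Pi i <= M.
Proof.
have [M hM] := integral_inner_sqr_summable; exists M.
apply/(nneseries_leP _ signal_var_ge0).
by under eq_eseriesr do rewrite -signal_varE.
Qed.

Section NoiseLaw.
Variable P : noise_law R.
Hypothesis csiP : centered_square_integrable P.
Local Notation Delta := (noise_var P).

Lemma measurable_coordinate_sqr n :
  measurable_fun [set: coef_space R] (fun e : coef_space R => (e n ^+ 2)%:E).
Proof.
by apply/measurable_EFinP; apply: measurable_funX; exact: coordinate_measurable.
Qed.

Lemma noise_varE n :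
  (\int[P]_e ((e : coef_space R) n ^+ 2)%:E = (Delta n)%:E)%E.
Proof.
rewrite /noise_var unlock fineK//.
exact: integrable_fin_num (csiP n).1.
Qed.

(* The minimum over g of (1 - g kappa_n)^2 Pi_n + g^2 Delta_n. *)
Definition mode_error n : R :=
  Pi n * Delta n / (kappa n ^+ 2 * Pi n + Delta n).

Lemma mode_errorE n :
  (1 - g_mse phi kappa Px P n * kappa n) ^+ 2 * Pi n
    + g_mse phi kappa Px P n ^+ 2 * Delta n = mode_error n.
Proof.
have [_ _ k0 _] := dfd; rewrite /mode_error /g_mse.
(* A zero denominator is a sum of two zero terms; as kappa_n > 0, both variances vanish and so do
   both sides. *)
have [D0|D0] := eqVneq (kappa n ^+ 2 * Pi n + Delta n) 0.
  have k2 : 0 < kappa n ^+ 2 by rewrite exprn_gt0.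
  have kp : 0 <= kappa n ^+ 2 * Pi n by rewrite mulr_ge0 ?(ltW k2) ?signal_var_ge0.
  move/eqP: D0; rewrite paddr_eq0 ?noise_var_ge0// mulf_eq0 gt_eqF//=.
  by move=> /andP[/eqP -> /eqP ->]; rewrite !mulr0 addr0 mul0r.
by field.
Qed.

Lemma mode_error_ge0 n : 0 <= mode_error n.
Proof.
by rewrite -mode_errorE addr_ge0// mulr_ge0 ?sqr_ge0 ?signal_var_ge0 ?noise_var_ge0.
Qed.

(** The bound is the value of the minimised quadratic at g = 0. *)
Lemma mode_error_le_signal n : mode_error n <= Pi n.
Proof.
have p0 := signal_var_ge0 n; have d0 := noise_var_ge0 P n.
have kp : 0 <= kappa n ^+ 2 * Pi n by rewrite mulr_ge0// sqr_ge0.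
rewrite /mode_error -mulrA ler_piMr//.
have [D0|D0] := eqVneq (kappa n ^+ 2 * Pi n + Delta n) 0.
  by rewrite D0 invr0 mulr0.
by rewrite ler_pdivrMr ?mul1r ?lerDr// lt_def D0 addr_ge0.
Qed.

(** The bound is the value of the minimised quadratic at g = 1 / kappa_n, the unregularised
    inversion. *)
Lemma mode_error_le_noise n : mode_error n <= Delta n / kappa n ^+ 2.
Proof.
have [_ _ k0 _] := dfd; have k2 : 0 < kappa n ^+ 2 by rewrite exprn_gt0.
have p0 := signal_var_ge0 n; have d0 := noise_var_ge0 P n.
have kp : 0 <= kappa n ^+ 2 * Pi n by rewrite mulr_ge0// sqr_ge0.
have [D0|D0] := eqVneq (kappa n ^+ 2 * Pi n + Delta n) 0.
  by rewrite /mode_error D0 invr0 mulr0 divr_ge0// ltW.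
have D1 : 0 < kappa n ^+ 2 * Pi n + Delta n by rewrite lt_def D0 addr_ge0.
rewrite ler_pdivrMr// mulrC -mulrA ler_wpM2l// mulrC ler_pdivlMr// mulrC.
by rewrite lerDl.
Qed.

(** Since (u - v)^2 <= 2 u^2 + 2 v^2, the integral splits into one over each marginal; the factor 2
    goes into the constant of the error bound. *)
Lemma integral_residual_sqr (s t : R) n :
  (\int[Px \x P]_w ((s * inner (w.1 : X) (phi n) - t * w.2 n) ^+ 2)%:E
   <= (2 * (s ^+ 2 * Pi n + t ^+ 2 * Delta n))%:E)%E.
Proof.
pose f1 (x : borel X) : \bar R := (inner (x : X) (phi n) ^+ 2)%:E.
pose f2 (e : coef_space R) : \bar R := (e n ^+ 2)%:E.
have f10 x : (0 <= f1 x)%E by rewrite lee_fin sqr_ge0.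
have f20 x : (0 <= f2 x)%E by rewrite lee_fin sqr_ge0.
have m1 : measurable_fun setT (fun w : borel X * coef_space R => f1 w.1).
  exact: (measurableT_comp (measurable_inner_sqr (phi n)) measurable_fst).
have m2 : measurable_fun setT (fun w : borel X * coef_space R => f2 w.2).
  exact: (measurableT_comp (measurable_coordinate_sqr n) measurable_snd).
have s0 : 0 <= 2 * s ^+ 2 by rewrite mulr_ge0// sqr_ge0.
have t0 : 0 <= 2 * t ^+ 2 by rewrite mulr_ge0// sqr_ge0.
apply: (@le_trans _ _ (\int[Px \x P]_w
    ((2 * s ^+ 2)%:E * f1 w.1 + (2 * t ^+ 2)%:E * f2 w.2))%E).
  apply: le_integral_ge0 => w; first by rewrite lee_fin sqr_ge0.
  rewrite -!EFinM -EFinD lee_fin.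
  have := sqr_ge0 (s * inner (w.1 : X) (phi n) + t * w.2 n).
  by move: (inner _ _) (w.2 n) => u v; lra.
rewrite ge0_integralD//; first last.
- exact: measurable_funeM.
- by move=> w _; rewrite mule_ge0.
- exact: measurable_funeM.
- by move=> w _; rewrite mule_ge0.
rewrite !ge0_integralZl_EFin//.
rewrite (integral_prod_fst _ _ (measurable_inner_sqr (phi n)))//.
rewrite (integral_prod_snd _ _ (measurable_coordinate_sqr n))//.
rewrite signal_varE noise_varE -!EFinM -EFinD lee_fin.
by rewrite mulrDr !mulrA.
Qed.

End NoiseLaw.

(** The pointwise error bound is integrated term by term, and the optimal filter turns each term
    into a mode error. The constant is chosen before [P], which makes the worst-case estimates
    uniform. *)
Lemma mean_squared_error_mse : exists2 K : R, 0 < K &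
  forall P : noise_law R, centered_square_integrable P ->
  (mean_squared_error A psi Px (R_mse A phi kappa Px P) P <=
   K%:E * \sum_(0 <= n <oo) (mode_error P n)%:E)%E.
Proof.
have [K K0 err] := reconstruction_error compact_A dfd.
exists (K * 2) => [|P csiP]; first by rewrite mulr_gt0.
pose g := g_mse phi kappa Px P.
pose d n (w : borel X * coef_space R) :=
  (1 - g n * kappa n) * inner (w.1 : X) (phi n) - g n * w.2 n.
have md n : measurable_fun setT (fun w => (d n w ^+ 2)%:E).
  apply/measurable_EFinP; apply: measurable_funX; apply: measurable_funB.
    apply: measurable_funM => //.
    exact: (measurableT_comp (measurable_inner (phi n)) measurable_fst).
  apply: measurable_funM => //.
  have mc := coordinate_measurable (R := R) n.
  have := measurableT_comp mc (@measurable_snd _ _ (borel X) (coef_space R)).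
  by apply.
have d0 n w : (0 <= (d n w ^+ 2)%:E)%E by rewrite lee_fin sqr_ge0.
apply: (@le_trans _ _
    (\int[Px \x P]_w (K%:E * \sum_(0 <= n <oo) (d n w ^+ 2)%:E))%E).
  apply: le_integral_ge0 => w; first by rewrite lee_fin sqr_ge0.
  exact: err.
rewrite ge0_integralZl_EFin ?(ltW K0)//; first last.
- by apply: ge0_emeasurable_sum.
- by move=> w _; exact: nneseries_ge0.
rewrite integral_nneseries// EFinM -muleA; apply: lee_wpmul2l.
  by rewrite lee_fin ltW.
rewrite -nneseriesZl; last by move=> n _; rewrite lee_fin mode_error_ge0.
apply: lee_nneseries => [n _ _|n _]; first exact: integral_ge0.
by rewrite -EFinM -mode_errorE; exact: integral_residual_sqr.
Qed.

End MeanSquaredError.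

(** * Sums of powers *)

Section PowerSums.
Context {R : realType}.
Implicit Types (a b p q t x y : R).

(* Derived from (x/y)^p <= 1 / (1 + p (1 - x/y)), which, unlike the tangent
   bound, needs no case distinction between p <= 1 and p >= 1. *)
Lemma powR_diff_ge p x y : 0 < p -> 0 <= x -> x <= y -> 0 < y ->
  p / (1 + p) * y `^ p * (1 - x / y) <= y `^ p - x `^ p.
Proof.
move=> p0 x0 xy y0; have yp : 0 < y `^ p by rewrite powR_gt0.
have p1 : 0 < 1 + p by rewrite addr_gt0.
have [->|xn0] := eqVneq x 0.
  rewrite powR0 ?gt_eqF// mul0r !subr0 mulr1 ler_piMl ?(ltW yp)//.
  by rewrite ler_pdivrMr// mul1r lerDr.
have xp : 0 < x by rewrite lt_def xn0.
have u0 : 0 < x / y by rewrite divr_gt0.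
set u := x / y in u0 *; have u1 : u <= 1 by rewrite ler_pdivrMr// mul1r.
have -> : x `^ p = u `^ p * y `^ p.
  by rewrite -powRM ?(ltW u0) ?(ltW y0)// divfK// gt_eqF.
clearbody u.
have d0 : 0 < 1 + p * (1 - u) by rewrite ltr_wpDr// mulr_ge0 ?subr_ge0// ltW.
(* Write 1 = u^p exp(- p ln u) and use exp(- p ln u) >= 1 - p ln u together with ln u <= u - 1. *)
have hu : u `^ p * (1 + p * (1 - u)) <= 1.
  rewrite [leRHS](_ : _ = u `^ p * expR (- (p * ln u))); last first.
    by rewrite /powR (gt_eqF u0) -expRD subrr expR0.
  rewrite ler_pM2l ?powR_gt0//; apply: le_trans (expR_ge1Dx _).
  rewrite lerD2l -mulrN ler_pM2l//.
  have := expR_ge1Dx (ln u); rewrite lnK ?posrE//; lra.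
(* After multiplication by 1 + p, the right side exceeds the left by the slack in [hu] plus p u (1 -
   u^p). *)
have h2 : p / (1 + p) * (1 - u) <= 1 - u `^ p.
  rewrite mulrAC ler_pdivrMr//.
  have up : 0 < u `^ p by rewrite powR_gt0.
  move: (u `^ p) hu up => U hu up.
  have h3 : 0 <= U * (p * (1 - u)) by rewrite !mulr_ge0 ?subr_ge0// ltW.
  have U1 : 0 <= 1 - U by move: h3 hu; rewrite mulrDr mulr1; lra.
  have : 0 <= p * u * (1 - U) by rewrite mulr_ge0// mulr_ge0// ltW.
  lra.
rewrite mulrAC; apply: le_trans (ler_wpM2r (ltW yp) h2) _.
by rewrite mulrBl mul1r.
Qed.

(** Telescoping: by [powR_diff_ge], n^(p - 1) is at most (1 + p) / p times n^p - (n - 1)^p. *)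
Lemma sum_powR_head p t N : 0 < p -> 0 < t ->
  \sum_(0 <= i < N | i.+1%:R <= t) i.+1%:R `^ (p - 1) <= (1 + p) / p * t `^ p.
Proof.
move=> p0 t0; have p1 : 0 < (1 + p) / p by rewrite divr_gt0// addr_gt0.
(* The minimum makes the induction work: the bound grows by the telescoping term while indices stay
   below [t], and no term is added afterwards. *)
suff h : \sum_(0 <= i < N | i.+1%:R <= t) i.+1%:R `^ (p - 1) <=
    (1 + p) / p * (Num.min N%:R t) `^ p.
  apply: le_trans h _; rewrite ler_pM2l// ge0_ler_powR ?nnegrE ?(ltW p0) ?(ltW t0)//.
    by rewrite le_min ler0n ltW.
  by rewrite ge_min lexx orbT.
elim: N => [|N IH].
  by rewrite big_geq// mulr_ge0 ?powR_ge0// ltW.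
rewrite big_mkcond big_nat_recr//= -big_mkcond/=.
have [Nt|tN] := leP N.+1%:R t; last first.
  rewrite addr0; apply: le_trans IH _; rewrite ler_pM2l//.
  rewrite ge0_ler_powR ?nnegrE ?(ltW p0)//.
  - by rewrite le_min ler0n ltW.
  - by rewrite ltW.
  - by rewrite ge_min lexx orbT.
have NN : N%:R <= N.+1%:R :> R by rewrite ler_nat.
rewrite (min_idPl (le_trans NN Nt)) in IH.
have := powR_diff_ge p0 (ler0n R N) NN (ltr0Sn R N).
have -> : 1 - N%:R / N.+1%:R = N.+1%:R^-1 :> R.
  have n0 : N.+1%:R != 0 :> R by rewrite pnatr_eq0.
  by apply: (mulIf n0); rewrite mulrBl divfK// mulVf// mul1r -natrB ?subSnn.
have -> : N.+1%:R `^ (p - 1) = N.+1%:R `^ p * N.+1%:R^-1 :> R.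
  by rewrite powRB ?pnatr_eq0 ?implybT// powRr1// ler0n.
set y := _ `^ p; set z := _%:R `^ p; set w := N.+1%:R^-1 => h.
have h2 : y * w <= (1 + p) / p * (y - z).
  have -> : y * w = (1 + p) / p * (p / (1 + p) * y * w).
    by field; rewrite !gt_eqF// addr_gt0.
  by rewrite ler_pM2l.
apply: le_trans (lerD IH h2) _.
by rewrite -mulrDr (addrC z) subrK.
Qed.

(** Telescoping with n^(- q) - (n + 1)^(- q). Since [powR_diff_ge] yields a factor 1 / (n + 1) where
    1 / n is wanted, the constant gains a factor 2. *)
Lemma sum_powR_tail q t N : 0 < q -> 0 < t ->
  \sum_(0 <= i < N | t < i.+1%:R) i.+1%:R `^ (- (q + 1)) <=
  2 * (1 + q) / q * t `^ (- q).
Proof.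
move=> q0 t0; set D := 2 * (1 + q) / q.
have D0 : 0 < D by rewrite divr_gt0// mulr_gt0// addr_gt0.
have dec x y : 0 < x -> x <= y -> y `^ (- q) <= x `^ (- q).
  move=> x0 xy; rewrite !powRN lef_pV2 ?posrE ?powR_gt0 ?(lt_le_trans x0)//.
  by rewrite ge0_ler_powR ?nnegrE ?(ltW q0) ?(ltW x0)// (le_trans (ltW x0)).
(* The subtracted term is the part of the telescoping sum still to come; the maximum leaves the
   bound at 0 until the index passes [t]. *)
suff h : \sum_(0 <= i < N | t < i.+1%:R) i.+1%:R `^ (- (q + 1)) <=
    D * (t `^ (- q) - (Num.max t N.+1%:R) `^ (- q)).
  by apply: le_trans h _; rewrite ler_pM2l// lerBlDr lerDl powR_ge0.
elim: N => [|N IH].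
  rewrite big_geq// mulr_ge0 ?(ltW D0)// subr_ge0 dec//.
  by rewrite le_max lexx.
rewrite big_mkcond big_nat_recr//= -big_mkcond/=.
have NN : N.+1%:R <= N.+2%:R :> R by rewrite ler_nat.
have [tN|Nt] := ltP t N.+1%:R; last first.
  rewrite addr0; apply: le_trans IH _; rewrite ler_pM2l// lerD2l lerN2 dec//.
    by rewrite lt_max t0.
  by rewrite ge_max !le_max lexx NN /= orbT.
rewrite (max_idPr (ltW tN)) in IH.
rewrite (max_idPr (le_trans (ltW tN) NN)).
have := powR_diff_ge q0 (ler0n R N.+1) NN (ltr0Sn R N.+1).
have n1 : N.+1%:R != 0 :> R by rewrite pnatr_eq0.
have n2 : N.+2%:R != 0 :> R by rewrite pnatr_eq0.
have -> : 1 - N.+1%:R / N.+2%:R = N.+2%:R^-1 :> R.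
  by apply: (mulIf n2); rewrite mulrBl divfK// mulVf// mul1r -natrB ?subSnn.
have -> : N.+1%:R `^ (- (q + 1)) = N.+1%:R `^ (- q) * N.+1%:R^-1 :> R.
  by rewrite opprD powRB ?pnatr_eq0 ?implybT// powRr1// ler0n.
have y0 : 0 < N.+2%:R `^ q :> R by rewrite powR_gt0// ltr0Sn.
have z0 : 0 < N.+1%:R `^ q :> R by rewrite powR_gt0// ltr0Sn.
move: IH; rewrite !powRN => IH h.
have yz : N.+1%:R^-1 <= 2 * N.+2%:R^-1 :> R.
  rewrite ler_pdivlMr ?ltr0Sn// mulrC ler_pdivrMr ?ltr0Sn//.
  by rewrite -natrM ler_nat; lia.
move: h IH y0 z0; set y := _ `^ q; set z := _%:R `^ q.
rewrite -/z => h IH y0 z0.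
have h2 : z^-1 * N.+1%:R^-1 <= D * (z^-1 - y^-1).
  apply: (@le_trans _ _ (z^-1 * (2 * N.+2%:R^-1))).
    by rewrite ler_pM2l// invr_gt0.
  have -> : D * (z^-1 - y^-1) = (2 * (1 + q) / q) * (y - z) / (y * z).
    by rewrite /D; field; rewrite !gt_eqF.
  rewrite ler_pdivlMr ?mulr_gt0//.
  have E w : z^-1 * (2 * w) * (y * z) = D * (q / (1 + q) * y * w).
    by rewrite /D; field; rewrite !gt_eqF// addr_gt0.
  by rewrite E ler_pM2l.
apply: le_trans (lerD IH h2) _.
by rewrite -mulrDr addrA subrK.
Qed.

(* Split at t = d^(-2/(a+b)) where the two power laws agree. *)
Lemma sum_min_powR a b : 1 < a -> -1 < b -> exists2 D : R, 0 <= D &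
  forall (d : R) N, 0 < d ->
  \sum_(0 <= i < N) Num.min (i.+1%:R `^ (- a)) (d ^+ 2 * i.+1%:R `^ b)
  <= D * d `^ (2 * ((a - 1) / (a + b))).
Proof.
move=> a1 b1.
have p0 : 0 < b + 1 by lra.
have q0 : 0 < a - 1 by lra.
have ab : 0 < a + b by lra.
exists ((1 + (b + 1)) / (b + 1) + 2 * (1 + (a - 1)) / (a - 1)).
  by rewrite addr_ge0// divr_ge0//; lra.
move=> d N d0; pose t := d `^ (- 2 / (a + b)).
have t0 : 0 < t by rewrite powR_gt0.
have e1 : d ^+ 2 * t `^ (b + 1) = d `^ (2 * ((a - 1) / (a + b))).
  rewrite -powR_mulrn ?(ltW d0)// -powRrM -powRD ?(gt_eqF d0) ?implybT//.
  by congr powR; field; rewrite gt_eqF.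
have e2 : t `^ (- (a - 1)) = d `^ (2 * ((a - 1) / (a + b))).
  by rewrite -powRrM; congr powR; field; rewrite gt_eqF.
(* Below [t] the law d^2 n^b is summed with p = b + 1, which is where [-1 < b] enters; above [t] the
   law n^(- a) is summed with q = a - 1. By [e1] and [e2] both parts have the claimed order. *)
rewrite (bigID (fun i => i.+1%:R <= t)) /= mulrDl; apply: lerD.
  rewrite -e1 mulrCA; apply: le_trans (ler_wpM2l (sqr_ge0 d) (sum_powR_head N p0 t0)).
  rewrite mulr_sumr; apply: ler_sum => i _.
  by rewrite ge_min addrK lexx orbT.
rewrite -e2; under eq_bigl do rewrite -ltNge.
apply: le_trans (sum_powR_tail N q0 t0); apply: ler_sum => i _.
by rewrite ge_min subrK lexx.
Qed.

End PowerSums.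

(** * Worst-case error and convergence rates *)

(** A level below a real number excludes an infinite supremum, and a supremum over a nonempty family
    of reals is not minus infinity; the level is then a real root. *)
Lemma noise_levelP (R : realType) (P : noise_law R) (d : R) :
  (noise_level P <= d%:E)%E -> exists r : R,
  [/\ noise_level P = r%:E, 0 <= r <= d & forall n, noise_var P n <= r ^+ 2].
Proof.
rewrite /noise_level.
have ub n : ((noise_var P n)%:E <= ereal_sup (range (fun n => (noise_var P n)%:E)))%E.
  by apply: ereal_sup_ubound; exists n.
case: (ereal_sup _) ub => [s ub|_|ub] /=; last 2 first.
- by rewrite leye_eq.
- by have := ub 0%N; rewrite leeNy_eq.
rewrite lee_fin => sd; exists (Num.sqrt s); split => // [|n].
  by rewrite sqrtr_ge0.
have := ub n; rewrite lee_fin => h; rewrite sqr_sqrtr//.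
exact: le_trans (noise_var_ge0 P n) h.
Qed.

Lemma big_nat_le_split (R : realType) (u : nat -> R) m n : (forall i, 0 <= u i) ->
  \sum_(0 <= i < n) u i <= \sum_(0 <= i < m) u i + \sum_(m <= i < maxn m n) u i.
Proof.
move=> u0; rewrite -big_cat_nat ?leq_maxl//=.
rewrite (@big_cat_nat _ _ _ n 0 (maxn m n)) ?leq_maxr//= lerDl.
exact: sumr_ge0.
Qed.

(** The finitely many exceptional indices are absorbed into the constant, as the sums to be bounded
    run over all indices. *)
Lemma near_le_all (R : realType) (u v : nat -> R) (C : R) :
  (forall n, 0 < v n) -> (\forall n \near \oo, u n <= C * v n) ->
  exists2 D : R, 0 <= D & forall n, u n <= D * v n.
Proof.
move=> v0 [N _ hN].
have S0 : 0 <= \sum_(0 <= i < N) `|u i / v i| by exact: sumr_ge0.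
exists (`|C| + \sum_(0 <= i < N) `|u i / v i|) => [|n]; first exact: addr_ge0.
have [Nn|nN] := leqP N n.
  apply: le_trans (hN n Nn) _; rewrite ler_pM2r//.
  by rewrite (le_trans (ler_norm C))// lerDl.
rewrite -ler_pdivrMr//; apply: le_trans (ler_norm _) _.
rewrite big_mkord (bigD1 (Ordinal nN))//= addrCA lerDl addr_ge0//.
exact: sumr_ge0.
Qed.

Section Rates.
Context {R : realType} {X Y : hilbertType R}.
Variables (A : {linear X -> Y}) (phi : nat -> X) (psi : nat -> Y).
Variables (kappa : nat -> R) (Px : probability (borel X) R).
Variable Psi : set (noise_law R).
Hypotheses (compact_A : compact_operator A)
  (second_moment : (\int[Px]_x (`|(x : X)| ^+ 2)%:E < +oo)%E)
  (noise_Psi : forall P, Psi P -> centered_square_integrable P)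
  (dfd : diagonal_frame_decomposition A phi psi kappa).

Local Notation Pi := (signal_var phi Px).
Local Notation m := (mode_error phi kappa Px).
Local Notation E := (worst_case_error A psi Px Psi (R_mse A phi kappa Px)).

Let kappa_gt0 n : 0 < kappa n.
Proof. by have [_ _ k0 _] := dfd. Qed.

Lemma worst_case_error_ge0 d : (0 <= E d)%E.
Proof. by apply: ereal_sup_ubound; left. Qed.

(** Common reduction for the limit and both rates: it remains to bound the partial sums of mode
    errors uniformly over noise laws of level r <= d. [0 <= B] takes care of the 0 adjoined to the
    supremum. *)
Lemma worst_case_error_le : exists2 K : R, 0 < K & forall d B, 0 <= B ->
  (forall P r, Psi P -> noise_level P = r%:E -> 0 <= r <= d ->
    (forall n, noise_var P n <= r ^+ 2) ->
    forall N, \sum_(0 <= i < N) m P i <= B) ->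
  (E d <= (K * B)%:E)%E.
Proof.
have [K K0 hK] := mean_squared_error_mse compact_A second_moment dfd.
exists K => // d B B0 h; apply: ge_ereal_sup => _ [->|[P [PsiP Pd] <-]].
  by rewrite lee_fin mulr_ge0// ltW.
have [r [Pr rd Dr]] := noise_levelP Pd.
apply: le_trans (hK P (noise_Psi PsiP)) _; rewrite EFinM.
apply: lee_wpmul2l; first by rewrite lee_fin ltW.
apply/nneseries_leP; first exact: mode_error_ge0 dfd _.
exact: h Pr rd Dr.
Qed.

(** Beyond a fixed index the tail of the summable Pi_n bounds the mode errors, uniformly in the
    noise law; before it they are at most d^2 / kappa_n^2. *)
Lemma worst_case_error_cvg : E d @[d --> 0^'+] --> 0%E.
Proof.
have [K K0 hK] := worst_case_error_le.
have [M PiM] := signal_var_summable second_moment dfd.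
suff h e : 0 < e -> \forall d \near 0^'+, (E d <= e%:E)%E.
  apply/fine_cvgP; split.
    apply: filterS (h 1 ltr01) => d d1.
    by rewrite ge0_fin_numE ?worst_case_error_ge0// (le_lt_trans d1)// ltry.
  apply/cvgrPdist_le => e e0; apply: filterS (h e e0) => d de.
  rewrite sub0r normrN ger0_norm ?fine_ge0 ?worst_case_error_ge0//.
  rewrite -lee_fin fineK// ge0_fin_numE ?worst_case_error_ge0//.
  by rewrite (le_lt_trans de)// ltry.
move=> e0; have eK : 0 < e / K / 2 by rewrite !divr_gt0.
have sqrtPi i : Num.sqrt (Pi i) ^+ 2 = Pi i by rewrite sqr_sqrtr// signal_var_ge0.
(* Square roots put the summable Pi_n into the form required by [sqsum_cauchy]. *)
have cM : sqsum_le (fun i => Num.sqrt (Pi i)) M.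
  by move=> N; under eq_bigr do rewrite sqrtPi.
have [N0 hN0] := sqsum_cauchy cM eK.
pose C := \sum_(0 <= i < N0) (kappa i ^+ 2)^-1.
have C0 : 0 < C + 1.
  by rewrite ltr_wpDl// sumr_ge0// => i _; rewrite invr_ge0 sqr_ge0.
have d0 : 0 < Num.min 1 (e / K / 2 / (C + 1)) by rewrite lt_min ltr01 divr_gt0.
near=> d.
have d1 : 0 < d by near: d; exact: nbhs_right_gt.
have : d <= Num.min 1 (e / K / 2 / (C + 1)) by near: d; exact: nbhs_right_le.
rewrite le_min => /andP[d_le1 dC].
have -> : e = K * (e / K) by rewrite mulrC divfK// gt_eqF.
apply: hK => [|P r PsiP _ /andP[r0 rd] Dr N]; first by rewrite divr_ge0// ltW.
apply: le_trans (big_nat_le_split N0 N (mode_error_ge0 Px dfd P)) _.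
rewrite [leRHS]splitr; apply: lerD.
  (* As d <= 1, d^2 is replaced by d, so that the threshold on d is linear in e. *)
  apply: (@le_trans _ _ (d * C)); last first.
    move: dC; rewrite ler_pdivlMr//; apply: le_trans.
    by rewrite ler_pM2l// lerDl.
  rewrite /C mulr_sumr; apply: ler_sum => i _.
  apply: le_trans (mode_error_le_noise _ dfd P i) _.
  rewrite ler_pM2r ?invr_gt0 ?exprn_gt0//; apply: le_trans (Dr i) _.
  apply: (@le_trans _ _ (d ^+ 2)); first by rewrite ler_pXn2r// nnegrE// ltW.
  by rewrite expr2 ler_piMl// ltW.
have hh : (N0 <= N0 <= maxn N0 N)%N by rewrite leqnn leq_maxl.
apply: le_trans _ (hN0 _ _ hh); apply: ler_sum => i _.
by rewrite sqrtPi mode_error_le_signal.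
Unshelve. all: by end_near. Qed.

(** For large n the denominator is at least Delta_n >= c kappa_n Pi_n, so the filter is at most 1 /
    c; [near_le_all] with weight 1 covers the other indices. *)
Lemma g_mse_bounded P (c : R) : 0 < c ->
  (\forall n \near \oo, c * (kappa n * Pi n) <= noise_var P n) ->
  exists G : R, forall n, `|g_mse phi kappa Px P n| <= G.
Proof.
move=> c0 hc; suff : \forall n \near \oo, `|g_mse phi kappa Px P n| <= c^-1 * 1.
  by move=> /near_le_all[//|D _ hD]; exists D => n; rewrite -[D]mulr1.
apply: filterS hc => n hn; rewrite mulr1 /g_mse.
have p0 := signal_var_ge0 phi Px n; have d0 := noise_var_ge0 P n.
have kp : 0 <= kappa n * Pi n by rewrite mulr_ge0// ltW.
have kkp : 0 <= kappa n ^+ 2 * Pi n by rewrite mulr_ge0// sqr_ge0.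
rewrite ger0_norm; last by rewrite divr_ge0// addr_ge0.
have [D0|D0] := eqVneq (kappa n ^+ 2 * Pi n + noise_var P n) 0.
  by rewrite D0 invr0 mulr0 invr_ge0 ltW.
rewrite ler_pdivrMr; last by rewrite lt_def D0 addr_ge0.
rewrite [leRHS]mulrC ler_pdivlMr// mulrC; apply: le_trans hn _.
by rewrite lerDr.
Qed.

Lemma rate_power (a b : R) : 1 < a -> -1 < b ->
  (exists C : R, \forall n \near \oo, Pi n <= C * n.+1%:R `^ (- a)) ->
  (exists C : R, \forall n \near \oo, forall P, Psi P ->
    ((noise_var P n / kappa n ^+ 2)%:E
      <= C%:E * (noise_level P ^+ 2 * (n.+1%:R `^ b)%:E))%E) ->
  exists C : R, forall d : R, 0 < d ->
    (E d <= (C * d `^ (2 * ((a - 1) / (a + b))))%:E)%E.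
Proof.
move=> a1 b1 [C1 hPi] [C2 [N2 _ hDelta]].
have [K K0 hK] := worst_case_error_le.
have pow0 s n : 0 < n.+1%:R `^ s :> R by rewrite powR_gt0.
have [D1 D10 hD1] := near_le_all (pow0 (- a)) hPi.
(* The power law for the noise holds only from [N2] on; earlier, Delta_n <= r^2 gives r^2 /
   kappa_n^2. The sequence [u] joins both bounds without reference to [P], so [D2] is uniform over
   [Psi]. *)
pose u n := if (n < N2)%N then (kappa n ^+ 2)^-1 else `|C2| * n.+1%:R `^ b.
have hu : \forall n \near \oo, u n <= `|C2| * n.+1%:R `^ b.
  by exists N2 => // n /= Nn; rewrite /u ltnNge Nn.
have [D2 D20 hD2] := near_le_all (pow0 b) hu.
have [D D0 hD] := sum_min_powR a1 b1.
exists (K * ((D1 + D2) * D)) => d d0.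
rewrite -!mulrA; apply: hK => [|P r PsiP Pr /andP[r0 rd] Dr N].
  by rewrite !mulr_ge0 ?powR_ge0// addr_ge0.
have rd2 : r ^+ 2 <= d ^+ 2 by rewrite ler_pXn2r// nnegrE// ltW.
apply: (@le_trans _ _ ((D1 + D2) *
    \sum_(0 <= i < N) Num.min (i.+1%:R `^ (- a)) (d ^+ 2 * i.+1%:R `^ b))); last first.
  by apply: ler_wpM2l; [exact: addr_ge0 | exact: hD].
rewrite mulr_sumr; apply: ler_sum => n _.
have DD : 0 <= D1 + D2 by exact: addr_ge0.
rewrite minr_pMr// le_min; apply/andP; split.
  apply: le_trans (mode_error_le_signal _ _ _ P n) _; apply: le_trans (hD1 n) _.
  by rewrite ler_pM2r// lerDl.
apply: le_trans (mode_error_le_noise _ dfd P n) _.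
apply: (@le_trans _ _ (d ^+ 2 * u n)); last first.
  rewrite mulrCA ler_wpM2l ?sqr_ge0//; apply: le_trans (hD2 n) _.
  by rewrite ler_pM2r// lerDr.
rewrite /u; case: ifPn => [_|]; last rewrite -leqNgt => Nn.
  by rewrite ler_pM2r ?invr_gt0 ?exprn_gt0//; exact: le_trans (Dr n) rd2.
have := hDelta n Nn P PsiP; rewrite Pr -EFin_expe -!EFinM lee_fin => /le_trans; apply.
rewrite mulrCA; apply: (@le_trans _ _ (r ^+ 2 * (`|C2| * n.+1%:R `^ b))).
  by rewrite ler_wpM2l ?sqr_ge0// ler_pM2r// ler_norm.
by rewrite ler_wpM2r// mulr_ge0// ltW.
Qed.

(** A minimum is at most a weighted geometric mean: each mode error is at most Pi_n^s' (Delta_n /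
    kappa_n^2)^s with s' + s = 1. The powers of kappa_n cancel because 4 mu s' = 2 s. For mu = 0 the
    convention 0^0 = 1 leaves the sum of the beta_n. *)
Lemma rate_source (mu c : R) (beta : nat -> R) : 0 <= mu ->
  (forall n, 0 <= beta n) ->
  (forall n, Pi n = kappa n `^ (4 * mu) * beta n) ->
  (forall P, Psi P -> exists gamma : nat -> R,
    [/\ forall n, 0 <= gamma n,
        forall n, ((noise_var P n)%:E = noise_level P ^+ 2 * (gamma n)%:E)%E &
        (\sum_(0 <= n <oo)
           (beta n `^ (1 / (1 + 2 * mu))
             * gamma n `^ (2 * mu / (1 + 2 * mu)))%:E <= c%:E)%E]) ->
  exists C : R, forall d : R, 0 < d ->
    (E d <= (C * d `^ (2 * (2 * mu / (1 + 2 * mu))))%:E)%E.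
Proof.
move=> mu0 beta0 hPi hP; have [K K0 hK] := worst_case_error_le.
exists (K * `|c|) => d d0; rewrite -mulrA.
have m1 : 0 < 1 + 2 * mu by lra.
set s := 2 * mu / (1 + 2 * mu); set s' := 1 / (1 + 2 * mu) in hP *.
have s0 : 0 <= s by rewrite divr_ge0 ?mulr_ge0// ltW.
have s'0 : 0 <= s' by rewrite divr_ge0// ltW.
have ss : s' + s = 1 by rewrite /s /s'; field; rewrite gt_eqF.
have ms : 4 * mu * s' = 2 * s by rewrite /s /s'; field; rewrite gt_eqF.
apply: hK => [|P r PsiP Pr /andP[r0 rd] Dr N]; first by rewrite mulr_ge0// powR_ge0.
have [gamma [gamma0 hgamma hc]] := hP P PsiP.
have bg0 n : 0 <= beta n `^ s' * gamma n `^ s by rewrite mulr_ge0 ?powR_ge0.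
move/(nneseries_leP _ bg0)/(_ N): hc => hc.
have h n : m P n <= d `^ (2 * s) * (beta n `^ s' * gamma n `^ s).
  have M0 := mode_error_ge0 Px dfd P n.
  have [->|Mn0] := eqVneq (m P n) 0; first by rewrite mulr_ge0 ?powR_ge0.
  have -> : m P n = m P n `^ s' * m P n `^ s.
    by rewrite -powRD ?ss ?powRr1// oner_eq0.
  have kn := kappa_gt0 n; have k0 := ltW kn.
  have Delta_n : noise_var P n = r ^+ 2 * gamma n.
    by have := hgamma n; rewrite Pr -EFin_expe -EFinM => -[].
  have hp : m P n `^ s' <= kappa n `^ (2 * s) * beta n `^ s'.
    rewrite -ms powRrM -powRM ?powR_ge0// -hPi.
    by rewrite ge0_ler_powR// ?nnegrE ?signal_var_ge0// mode_error_le_signal.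
  have hd : m P n `^ s <= d `^ (2 * s) / kappa n `^ (2 * s) * gamma n `^ s.
    have -> : d `^ (2 * s) / kappa n `^ (2 * s) * gamma n `^ s =
        (d ^+ 2 / kappa n ^+ 2 * gamma n) `^ s.
      rewrite powRM ?divr_ge0 ?sqr_ge0// powRM ?invr_ge0 ?sqr_ge0//.
      rewrite -(powR_inv1 (sqr_ge0 (kappa n))) -!powR_mulrn ?(ltW d0)// -!powRrM -powRN.
      by congr (_ * _ `^ _ * _); ring.
    rewrite ge0_ler_powR// ?nnegrE//.
      by rewrite mulr_ge0// divr_ge0// sqr_ge0.
    apply: le_trans (mode_error_le_noise _ dfd P n) _.
    rewrite Delta_n mulrAC ler_wpM2r// ler_pM2r ?invr_gt0 ?exprn_gt0//.
    by rewrite ler_pXn2r// nnegrE// ltW.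
  apply: le_trans (ler_pM _ _ hp hd) _; rewrite ?powR_ge0//.
  have k2 : 0 < kappa n `^ (2 * s) by rewrite powR_gt0.
  move: (kappa n `^ (2 * s)) k2 => k k2; rewrite le_eqVlt; apply/orP; left; apply/eqP.
  by field; rewrite gt_eqF.
apply: le_trans (ler_sum _ (fun n _ => h n)) _.
rewrite -mulr_sumr mulrC ler_wpM2r ?powR_ge0//.
exact: le_trans hc (ler_norm c).
Qed.

End Rates.

Theorem theorem5 (R : realType) (X Y : hilbertType R) (A : {linear X -> Y})
    (phi : nat -> X) (psi : nat -> Y) (kappa : nat -> R)
    (Px : probability (borel X) R) (Psi : set (noise_law R))
    (compact_A : compact_operator A)
    (second_moment :
      (\int[Px]_x (`|(x : X)| ^+ 2)%:E < +oo)%E)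
    (noise_Psi : forall P, Psi P -> centered_square_integrable P)
    (dfd : diagonal_frame_decomposition A phi psi kappa)
    (noise_lower : forall P, Psi P -> exists2 c : R, 0 < c &
      \forall n \near \oo,
        c * (kappa n * signal_var phi Px n) <= noise_var P n) :
  let Rm := R_mse A phi kappa Px in
  let E := worst_case_error A psi Px Psi Rm in
  [/\ data_driven_regularization psi Psi Rm,
      convergent_over A psi Px Psi Rm,
      E delta @[delta --> 0^'+] --> 0%E,
      (forall a b : R, 1 < a -> -1 < b ->
        (exists C : R, \forall n \near \oo,
          signal_var phi Px n <= C * n.+1%:R `^ (- a)) ->
        (exists C : R, \forall n \near \oo, forall P, Psi P ->
          ((noise_var P n / kappa n ^+ 2)%:E
            <= C%:E * (noise_level P ^+ 2 * (n.+1%:R `^ b)%:E))%E) ->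
        exists C : R, forall delta : R, 0 < delta ->
          (E delta <= (C * delta `^ (2 * ((a - 1) / (a + b))))%:E)%E) &
      (forall (mu c : R) (beta : nat -> R), 0 <= mu ->
        (forall n, 0 <= beta n) ->
        (forall n, signal_var phi Px n = kappa n `^ (4 * mu) * beta n) ->
        (forall P, Psi P -> exists gamma : nat -> R,
          [/\ forall n, 0 <= gamma n,
              forall n, ((noise_var P n)%:E
                          = noise_level P ^+ 2 * (gamma n)%:E)%E &
              (\sum_(0 <= n <oo)
                 (beta n `^ (1 / (1 + 2 * mu))
                   * gamma n `^ (2 * mu / (1 + 2 * mu)))%:E <= c%:E)%E]) ->
        exists C : R, forall delta : R, 0 < delta ->
          (E delta <= (C * delta `^ (2 * (2 * mu / (1 + 2 * mu))))%:E)%E)].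
Proof.
move=> Rm E; split.
- move=> P PsiP; have [c c0 hc] := noise_lower P PsiP.
  have [G hG] := g_mse_bounded dfd c0 hc.
  exact: (coef_reg_continuous dfd hG).
(* The parameter choice rule keeps the true noise law. *)
- exists (fun _ P => P); split=> //.
  exact: worst_case_error_cvg compact_A second_moment noise_Psi dfd.
- exact: worst_case_error_cvg compact_A second_moment noise_Psi dfd.
- exact: rate_power compact_A second_moment noise_Psi dfd.
- exact: rate_source compact_A second_moment noise_Psi dfd.
Qed.
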